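(* Let $A$ be a Hermitian Banach $*$-algebra and let $D$ be a closed $*$-subalgebra of $A$ (a normed $*$-algebra with the inherited norm). Then every state on $D$ extends to a state on $A$.
   Context: All algebras are complex. A Banach $*$-algebra is a complete complex algebra with an involution $a\mapsto a^*$ (conjugate linear, $(ab)^*=b^*a^*$, $a^{**}=a$) and a norm with $|ab|\le|a||b|$; the involution need not be continuous. $A$ is Hermitian if every Hermitian element ($a=a^*$) has real spectrum. For a normed $*$-algebra $B$, let $B_{sa}=\{b:b=b^*\}$. A linear functional $\varphi$ on $B$ is positive if $\varphi(b^*b)\ge0$ for all $b$; it is weakly continuous on $B_{sa}$ if for each $c\in B$ the functional $b\mapsto\varphi(c^*bc)$ is norm-continuous on $B_{sa}$; it has finite variation if there is $\gamma\ge0$ with $|\varphi(b)|^2\le\gamma\varphi(b^*b)$ for all $b$, the least such $\gamma$ being the variation $v(\varphi)$. A state on $B$ is a positive linear functional, weakly continuous on $B_{sa}$, with $v(\varphi)=1$. *)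

(* Defs.v *)
From Stdlib Require Import Reals.
Open Scope R_scope.

Record Cpx := mkC { Cre : R; Cim : R }.

Definition C0 : Cpx := mkC 0 0.
Definition C1 : Cpx := mkC 1 0.
Definition Cadd (z w : Cpx) : Cpx := mkC (Cre z + Cre w) (Cim z + Cim w).
Definition Copp (z : Cpx) : Cpx := mkC (- Cre z) (- Cim z).
Definition Cmul (z w : Cpx) : Cpx :=
  mkC (Cre z * Cre w - Cim z * Cim w) (Cre z * Cim w + Cim z * Cre w).
Definition Cconj (z : Cpx) : Cpx := mkC (Cre z) (- Cim z).
Definition Cmod (z : Cpx) : R := sqrt (Cre z * Cre z + Cim z * Cim z).
Definition Cinv (z : Cpx) : Cpx :=
  let d := Cre z * Cre z + Cim z * Cim z in mkC (Cre z / d) (- Cim z / d).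

(* ---------- Banach *-algebras (involution not assumed continuous) ---------- *)
Record BanachStarAlgebra := {
  bs_car :> Type;
  bs_zero : bs_car;
  bs_add : bs_car -> bs_car -> bs_car;
  bs_opp : bs_car -> bs_car;
  bs_scal : Cpx -> bs_car -> bs_car;
  bs_mul : bs_car -> bs_car -> bs_car;
  bs_star : bs_car -> bs_car;
  bs_norm : bs_car -> R;
  bs_add_assoc : forall x y z, bs_add x (bs_add y z) = bs_add (bs_add x y) z;
  bs_add_comm : forall x y, bs_add x y = bs_add y x;
  bs_add_zero : forall x, bs_add bs_zero x = x;
  bs_add_opp : forall x, bs_add (bs_opp x) x = bs_zero;
  bs_scal_assoc : forall a b x, bs_scal a (bs_scal b x) = bs_scal (Cmul a b) x;
  bs_scal_one : forall x, bs_scal C1 x = x;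
  bs_scal_addl : forall a b x, bs_scal (Cadd a b) x = bs_add (bs_scal a x) (bs_scal b x);
  bs_scal_addr : forall a x y, bs_scal a (bs_add x y) = bs_add (bs_scal a x) (bs_scal a y);
  bs_mul_assoc : forall x y z, bs_mul x (bs_mul y z) = bs_mul (bs_mul x y) z;
  bs_mul_addl : forall x y z, bs_mul (bs_add x y) z = bs_add (bs_mul x z) (bs_mul y z);
  bs_mul_addr : forall x y z, bs_mul x (bs_add y z) = bs_add (bs_mul x y) (bs_mul x z);
  bs_mul_scall : forall a x y, bs_mul (bs_scal a x) y = bs_scal a (bs_mul x y);
  bs_mul_scalr : forall a x y, bs_mul x (bs_scal a y) = bs_scal a (bs_mul x y);
  bs_star_add : forall x y, bs_star (bs_add x y) = bs_add (bs_star x) (bs_star y);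
  bs_star_scal : forall a x, bs_star (bs_scal a x) = bs_scal (Cconj a) (bs_star x);
  bs_star_mul : forall x y, bs_star (bs_mul x y) = bs_mul (bs_star y) (bs_star x);
  bs_star_star : forall x, bs_star (bs_star x) = x;
  bs_norm_nonneg : forall x, 0 <= bs_norm x;
  bs_norm_eq0 : forall x, bs_norm x = 0 -> x = bs_zero;
  bs_norm_triangle : forall x y, bs_norm (bs_add x y) <= bs_norm x + bs_norm y;
  bs_norm_scal : forall a x, bs_norm (bs_scal a x) = Cmod a * bs_norm x;
  bs_norm_mul : forall x y, bs_norm (bs_mul x y) <= bs_norm x * bs_norm y;
  bs_complete : forall u : nat -> bs_car,
    (forall eps, 0 < eps -> exists N, forall m n, (N <= m)%nat -> (N <= n)%nat ->
        bs_norm (bs_add (u m) (bs_opp (u n))) < eps) ->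
    exists l, forall eps, 0 < eps -> exists N, forall n, (N <= n)%nat ->
        bs_norm (bs_add (u n) (bs_opp l)) < eps
}.

Arguments bs_zero {_}.
Arguments bs_add {_}.
Arguments bs_opp {_}.
Arguments bs_scal {_}.
Arguments bs_mul {_}.
Arguments bs_star {_}.
Arguments bs_norm {_}.

Section Defs.
Variable A : BanachStarAlgebra.

Definition bs_sub (x y : A) : A := bs_add x (bs_opp y).

Definition qprod (x y : A) : A := bs_sub (bs_add x y) (bs_mul x y).
Definition quasi_invertible (x : A) : Prop :=
  exists y : A, qprod x y = bs_zero /\ qprod y x = bs_zero.

(* spectrum in a possibly non-unital algebra (i.e. relative to the unitization):
   0 always lies in it, and lam <> 0 lies in it iff lam^{-1} a is not
   quasi-invertible. *)
Definition in_spectrum (a : A) (lam : Cpx) : Prop :=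
  lam = C0 \/ ~ quasi_invertible (bs_scal (Cinv lam) a).

Definition hermitian_elt (a : A) : Prop := bs_star a = a.

Definition hermitian_algebra : Prop :=
  forall a : A, hermitian_elt a -> forall lam, in_spectrum a lam -> Cim lam = 0.

Definition closed_star_subalgebra (D : A -> Prop) : Prop :=
  D bs_zero /\
  (forall x y, D x -> D y -> D (bs_add x y)) /\
  (forall a x, D x -> D (bs_scal a x)) /\
  (forall x y, D x -> D y -> D (bs_mul x y)) /\
  (forall x, D x -> D (bs_star x)) /\
  (forall (u : nat -> A) (l : A), (forall n, D (u n)) ->
     (forall eps, 0 < eps -> exists N, forall n, (N <= n)%nat ->
        bs_norm (bs_sub (u n) l) < eps) -> D l).

(* notions for a normed *-algebra B, given as a *-subalgebra B of A with the
   inherited norm; functionals are total functions A -> C of which only the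
   values on B matter. *)
Section OnB.
Variable B : A -> Prop.
Variable phi : A -> Cpx.

Definition linear_on : Prop :=
  (forall x y, B x -> B y -> phi (bs_add x y) = Cadd (phi x) (phi y)) /\
  (forall a x, B x -> phi (bs_scal a x) = Cmul a (phi x)).

Definition positive_on : Prop :=
  forall b, B b -> Cim (phi (bs_mul (bs_star b) b)) = 0 /\
                   0 <= Cre (phi (bs_mul (bs_star b) b)).

Definition weakly_continuous_on_sa : Prop :=
  forall c, B c ->
  forall b0, B b0 -> hermitian_elt b0 ->
  forall eps, 0 < eps -> exists delta, 0 < delta /\
    forall b, B b -> hermitian_elt b -> bs_norm (bs_sub b b0) < delta ->
      Cmod (Cadd (phi (bs_mul (bs_star c) (bs_mul b c)))
                 (Copp (phi (bs_mul (bs_star c) (bs_mul b0 c))))) < eps.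

Definition variation_bound (gamma : R) : Prop :=
  0 <= gamma /\
  forall b, B b -> Cmod (phi b) ^ 2 <= gamma * Cre (phi (bs_mul (bs_star b) b)).

Definition variation_one : Prop :=
  variation_bound 1 /\ forall gamma, variation_bound gamma -> 1 <= gamma.

Definition is_state : Prop :=
  linear_on /\ positive_on /\ weakly_continuous_on_sa /\ variation_one.
End OnB.
End Defs.

Arguments hermitian_algebra : clear implicits.

(* Main.v *)
(* Pass to the unitization of A and call a hermitian element positive when its spectrum is
   nonnegative. Ford's square root lemma gives Ptak's inequality r(a)^2 <= r(a^* a), hence
   r(ab) <= r(a) r(b) for hermitian a, b, hence positive elements form a cone, and the
   Shirali-Ford theorem says that this cone contains every a^* a.

   Let phi be a state on D. By iterated Cauchy-Schwarz and weak continuity,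
   |phi (c^* x c)| <= phi (c^* c) r(x) for c in D and x hermitian in C1 + D. Because phi has
   variation one, there are c in D with phi (c^* c) = 1 and |phi c| close to 1, and for these
   phi (c^* x c) is close to the value at x of the extension of phi by phi 1 = 1. So this
   extension is nonnegative on the positive elements of C1 + D, and M. Riesz' theorem extends
   it to all hermitian elements, the unit being an order unit. The resulting functional is
   dominated by the norm on hermitian elements, hence weakly continuous, and its variation is
   at most its value at 1. *)
From Stdlib Require Import Reals Lra Lia Psatz List Classical ClassicalEpsilon.
From Coquelicot Require Import Rcomplements Compactness.
From mathcomp.classical Require classical_sets.
Require Import Defs.
Import ListNotations.
Open Scope R_scope.

(** * Complex numbers *)

(** The involution may be discontinuous, so norm estimates do not pass to adjoints and limits of
    hermitian elements need not be hermitian. Invertibility does pass to adjoints, and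
    [small_of_resolvent] is the bridge back: invertibility of 1 - c a for all |c| <= 1 becomes
    geometric decay of the powers of a. The spectral radius itself is never formed; only the
    property that it is below one is used, and inequalities between spectral radii appear as
    implications between such properties. Powers x^(2^k) prevail because squaring is what
    Cauchy-Schwarz, Ptak's inequality and averaging over roots of unity iterate. On the side of
    states, D need not have a unit, and phi is continuous only through the functionals phi (c^* b
    c). Variation at most one says that the covariance phi (y^* x) - phi x conj(phi y) is a positive
    form. A near-maximizer c has almost no variance, so by Cauchy-Schwarz it is almost uncorrelated
    with each x in D; this is why phi (c^* h c) comes close to phi h. *)

Lemma Cpx_ext (z w : Cpx) : Cre z = Cre w -> Cim z = Cim w -> z = w.
Proof. destruct z, w; simpl; intros; subst; reflexivity. Qed.

Definition RtoC (r : R) : Cpx := mkC r 0.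

Ltac creal := apply Cpx_ext; unfold RtoC, C0, C1, Cadd, Copp, Cmul, Cconj; simpl;
  first [ring | lra | (field; repeat split; first [assumption | lra])].

Lemma Cmod_ge0 (z : Cpx) : 0 <= Cmod z.
Proof. apply sqrt_pos. Qed.

Lemma Cmod_sqr (z : Cpx) : Cmod z ^ 2 = Cre z * Cre z + Cim z * Cim z.
Proof. unfold Cmod; rewrite pow2_sqrt; [reflexivity | nra]. Qed.

Lemma Cmod_unique (z : Cpx) (r : R) :
  0 <= r -> r ^ 2 = Cre z * Cre z + Cim z * Cim z -> Cmod z = r.
Proof.
  intros Hr H; rewrite <- Cmod_sqr in H.
  pose proof (Cmod_ge0 z); nra.
Qed.

Lemma Cmod_mul (z w : Cpx) : Cmod (Cmul z w) = Cmod z * Cmod w.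
Proof.
  apply Cmod_unique.
  - apply Rmult_le_pos; apply Cmod_ge0.
  - rewrite Rpow_mult_distr, !Cmod_sqr; simpl; ring.
Qed.

Lemma Cmod_conj (z : Cpx) : Cmod (Cconj z) = Cmod z.
Proof. apply Cmod_unique; [apply Cmod_ge0 |]; rewrite Cmod_sqr; simpl; ring. Qed.

Lemma Cmod_opp (z : Cpx) : Cmod (Copp z) = Cmod z.
Proof. apply Cmod_unique; [apply Cmod_ge0 |]; rewrite Cmod_sqr; simpl; ring. Qed.

Lemma Cmod_RtoC (r : R) : Cmod (RtoC r) = Rabs r.
Proof.
  apply Cmod_unique; [apply Rabs_pos |]; simpl.
  rewrite Rmult_1_r, <- Rabs_mult, Rabs_pos_eq; nra.
Qed.

Lemma Cmod_pos_RtoC (r : R) : 0 <= r -> Cmod (RtoC r) = r.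
Proof. intros; rewrite Cmod_RtoC; apply Rabs_pos_eq; assumption. Qed.

Lemma Rle_of_sqr_le (a b : R) : 0 <= b -> a ^ 2 <= b ^ 2 -> a <= b.
Proof. intros; apply Rnot_lt_le; intro; nra. Qed.

Lemma Cmod_triangle (z w : Cpx) : Cmod (Cadd z w) <= Cmod z + Cmod w.
Proof.
  pose proof (Cmod_ge0 z) as Hz; pose proof (Cmod_ge0 w) as Hw.
  apply Rle_of_sqr_le; [lra |].
  replace ((Cmod z + Cmod w) ^ 2) with (Cmod z ^ 2 + Cmod w ^ 2 + 2 * (Cmod z * Cmod w)) by ring.
  rewrite <- Cmod_mul.
  assert (Cre z * Cre w + Cim z * Cim w <= Cmod (Cmul z w)).
  { apply Rle_of_sqr_le; [apply Cmod_ge0 |].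
    rewrite Cmod_sqr; simpl.
    pose proof (pow2_ge_0 (Cre z * Cim w - Cim z * Cre w)); simpl in *; nra. }
  rewrite !Cmod_sqr; simpl; nra.
Qed.

Lemma Cmod_re (z : Cpx) : Rabs (Cre z) <= Cmod z.
Proof.
  apply Rle_of_sqr_le; [apply Cmod_ge0 |].
  rewrite Cmod_sqr, pow2_abs; nra.
Qed.

Lemma Cmod_im (z : Cpx) : Rabs (Cim z) <= Cmod z.
Proof.
  apply Rle_of_sqr_le; [apply Cmod_ge0 |].
  rewrite Cmod_sqr, pow2_abs; nra.
Qed.

Lemma Cmod_le_abs (z : Cpx) : Cmod z <= Rabs (Cre z) + Rabs (Cim z).
Proof.
  pose proof (Rabs_pos (Cre z)); pose proof (Rabs_pos (Cim z)).
  apply Rle_of_sqr_le; [lra |].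
  rewrite Cmod_sqr.
  pose proof (pow2_abs (Cre z)); pose proof (pow2_abs (Cim z)); simpl in *; nra.
Qed.

Lemma Cmod_eq0 (z : Cpx) : Cmod z = 0 -> z = C0.
Proof.
  intro H; pose proof (Cmod_sqr z) as H2; rewrite H in H2.
  apply Cpx_ext; simpl; nra.
Qed.

Lemma Cmul_inv (z : Cpx) : z <> C0 -> Cmul z (Cinv z) = C1.
Proof.
  intro H.
  assert (Cre z * Cre z + Cim z * Cim z <> 0).
  { intro H0; apply H; apply Cpx_ext; simpl; nra. }
  apply Cpx_ext; simpl; field; assumption.
Qed.

Lemma Cinv_mul (z : Cpx) : z <> C0 -> Cmul (Cinv z) z = C1.
Proof. intro H; rewrite <- (Cmul_inv z H); creal. Qed.

Lemma Cinv_im (z : Cpx) : Cim z <> 0 -> Cim (Cinv z) <> 0.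
Proof.
  intro H; simpl.
  assert (0 < Cre z * Cre z + Cim z * Cim z) by nra.
  unfold Rdiv; apply Rmult_integral_contrapositive_currified; [lra |].
  apply Rinv_neq_0_compat; lra.
Qed.

(** Half-angle formulas; the sign of [Cim w] decides the sign of the imaginary part. The averaging
    of resolvents over z and -z needs these roots. *)
Lemma Csqrt_unit (w : Cpx) : Cmod w = 1 ->
  exists z, Cmod z = 1 /\ Cmul z z = w.
Proof.
  intro H; pose proof (Cmod_sqr w) as Hs; rewrite H in Hs.
  destruct w as [u v]; simpl in *.
  assert (Hu : 0 <= (1 + u) / 2 /\ 0 <= (1 - u) / 2) by nra.
  set (a := sqrt ((1 + u) / 2)); set (b := sqrt ((1 - u) / 2)).
  assert (Ha : a * a = (1 + u) / 2) by (apply sqrt_sqrt; lra).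
  assert (Hb : b * b = (1 - u) / 2) by (apply sqrt_sqrt; lra).
  assert (Hab : (2 * a * b - v) * (2 * a * b + v) = 0) by nra.
  apply Rmult_integral in Hab; destruct Hab as [Hab | Hab].
  - exists (mkC a b); split; [apply Cmod_unique; simpl; lra |].
    apply Cpx_ext; simpl; lra.
  - exists (mkC a (- b)); split; [apply Cmod_unique; simpl; nra |].
    apply Cpx_ext; simpl; nra.
Qed.

(** * Unital algebras and a normalisation tactic *)

Infix "+'" := bs_add (at level 50, left associativity).
Infix "*'" := bs_mul (at level 40, left associativity).
Infix "-'" := (@bs_sub _) (at level 50, left associativity).
Infix "*:" := bs_scal (at level 40, left associativity).
Notation "x ^*" := (bs_star x) (at level 2, left associativity, format "x ^*").

Record UnitalBanachStarAlgebra := {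
  ub_alg :> BanachStarAlgebra;
  one : ub_alg;
  mul_one_l : forall x, one *' x = x;
  mul_one_r : forall x, x *' one = x;
  norm_one : bs_norm one = 1
}.
Arguments one {_}.

Section Basic.
Variable A : BanachStarAlgebra.
Implicit Types x y z : A.

Lemma add_zero_r x : x +' bs_zero = x.
Proof. rewrite bs_add_comm; apply bs_add_zero. Qed.

Lemma add_opp_r x : x +' bs_opp x = bs_zero.
Proof. rewrite bs_add_comm; apply bs_add_opp. Qed.

Lemma add_cancel_l x y z : x +' y = x +' z -> y = z.
Proof.
  intro H; rewrite <- (bs_add_zero _ y), <- (bs_add_zero _ z), <- (bs_add_opp _ x).
  rewrite <- !bs_add_assoc, H; reflexivity.
Qed.

Lemma scal_zero_l x : C0 *: x = bs_zero.
Proof.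
  apply (add_cancel_l (C0 *: x)); rewrite <- bs_scal_addl, add_zero_r.
  f_equal; creal.
Qed.

Lemma scal_zero_r (c : Cpx) : c *: (bs_zero : A) = bs_zero.
Proof.
  apply (add_cancel_l (c *: bs_zero)); rewrite <- bs_scal_addr, !add_zero_r; reflexivity.
Qed.

Lemma opp_scal x : bs_opp x = Copp C1 *: x.
Proof.
  apply (add_cancel_l x); rewrite add_opp_r.
  rewrite <- (bs_scal_one _ x) at 1; rewrite <- bs_scal_addl.
  replace (Cadd C1 (Copp C1)) with C0 by creal.
  symmetry; apply scal_zero_l.
Qed.

Lemma mul_zero_l x : bs_zero *' x = bs_zero.
Proof. rewrite <- (scal_zero_l bs_zero) at 1; rewrite bs_mul_scall; apply scal_zero_l. Qed.

Lemma mul_zero_r x : x *' bs_zero = bs_zero.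
Proof. rewrite <- (scal_zero_l bs_zero) at 1; rewrite bs_mul_scalr; apply scal_zero_l. Qed.

Lemma star_opp x : (bs_opp x)^* = bs_opp x^*.
Proof. rewrite !opp_scal, bs_star_scal; f_equal; creal. Qed.

Lemma star_zero : (bs_zero : A)^* = bs_zero.
Proof.
  rewrite <- (scal_zero_l bs_zero) at 1; rewrite bs_star_scal.
  replace (Cconj C0) with C0 by creal; apply scal_zero_l.
Qed.

Lemma star_sub x y : (x -' y)^* = x^* -' y^*.
Proof. unfold bs_sub; rewrite bs_star_add, star_opp; reflexivity. Qed.

Lemma norm_zero : bs_norm (bs_zero : A) = 0.
Proof.
  rewrite <- (scal_zero_l bs_zero) at 1; rewrite bs_norm_scal.
  replace (Cmod C0) with 0; [ring |].
  symmetry; apply Cmod_unique; simpl; lra.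
Qed.

Lemma norm_opp x : bs_norm (bs_opp x) = bs_norm x.
Proof.
  rewrite opp_scal, bs_norm_scal.
  replace (Cmod (Copp C1)) with 1; [ring |].
  symmetry; apply Cmod_unique; simpl; lra.
Qed.

Lemma norm_scal_R (r : R) x : 0 <= r -> bs_norm (RtoC r *: x) = r * bs_norm x.
Proof. intro; rewrite bs_norm_scal, Cmod_pos_RtoC; auto. Qed.

Lemma norm_sub_le x y : bs_norm (x -' y) <= bs_norm x + bs_norm y.
Proof. unfold bs_sub; rewrite <- (norm_opp y); apply bs_norm_triangle. Qed.

Lemma star_RtoC (r : R) x : (RtoC r *: x)^* = RtoC r *: x^*.
Proof. rewrite bs_star_scal; f_equal; creal. Qed.

End Basic.

(* Reflexive normalisation in unital algebras: an expression becomes a list of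
   coefficients times words in the atoms, like words merged, so that an identity reduces to
   the vanishing of finitely many coefficients. *)
Inductive aexp :=
| AVar (n : nat) | AZero | AOne | AAdd (x y : aexp) | ASub (x y : aexp) | AOpp (x : aexp)
| AMul (x y : aexp) | AScal (c : Cpx) (x : aexp).

Definition apoly := list (Cpx * list nat).

Fixpoint word_eqb (u v : list nat) : bool :=
  match u, v with
  | [], [] => true
  | a :: u', b :: v' => andb (Nat.eqb a b) (word_eqb u' v')
  | _, _ => false
  end.

Fixpoint poly_addm (m : Cpx * list nat) (p : apoly) : apoly :=
  match p with
  | [] => [m]
  | (c, w) :: p' =>
      if word_eqb (snd m) w then (Cadd (fst m) c, w) :: p' else (c, w) :: poly_addm m p'
  end.

Definition poly_add (p q : apoly) : apoly := fold_right poly_addm q p.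
Definition poly_mulm (c : Cpx) (w : list nat) (p : apoly) : apoly :=
  map (fun m => (Cmul c (fst m), w ++ snd m)) p.
Definition poly_mul (p q : apoly) : apoly :=
  fold_right (fun m acc => poly_add (poly_mulm (fst m) (snd m) q) acc) [] p.

Fixpoint poly_of (x : aexp) : apoly :=
  match x with
  | AVar n => [(C1, [n])]
  | AZero => []
  | AOne => [(C1, [])]
  | AAdd x y => poly_add (poly_of x) (poly_of y)
  | ASub x y => poly_add (poly_of x) (poly_mulm (Copp C1) [] (poly_of y))
  | AOpp x => poly_mulm (Copp C1) [] (poly_of x)
  | AMul x y => poly_mul (poly_of x) (poly_of y)
  | AScal c x => poly_mulm c [] (poly_of x)
  end.

Fixpoint poly_null (p : apoly) : Prop :=
  match p with [] => True | (c, _) :: p' => c = C0 /\ poly_null p' end.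

Section Denote.
Variable U : UnitalBanachStarAlgebra.
Variable env : list U.

Fixpoint aden (x : aexp) : U :=
  match x with
  | AVar n => nth n env bs_zero
  | AZero => bs_zero
  | AOne => one
  | AAdd x y => aden x +' aden y
  | ASub x y => aden x -' aden y
  | AOpp x => bs_opp (aden x)
  | AMul x y => aden x *' aden y
  | AScal c x => c *: aden x
  end.

Definition wden (w : list nat) : U :=
  fold_right (fun n acc => nth n env bs_zero *' acc) one w.
Definition pden (p : apoly) : U :=
  fold_right (fun m acc => fst m *: wden (snd m) +' acc) bs_zero p.

Lemma word_eqb_eq u v : word_eqb u v = true -> u = v.
Proof.
  revert v; induction u as [| a u IH]; intros [| b v]; simpl; try discriminate; auto.
  intro H; apply andb_prop in H as [H1 H2].
  apply Nat.eqb_eq in H1; subst; f_equal; auto.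
Qed.

Lemma pden_addm m p : pden (poly_addm m p) = fst m *: wden (snd m) +' pden p.
Proof.
  induction p as [| [c w] p IH]; simpl; auto.
  destruct (word_eqb (snd m) w) eqn:E; simpl.
  - apply word_eqb_eq in E; subst.
    rewrite bs_scal_addl, bs_add_assoc; reflexivity.
  - rewrite IH, !bs_add_assoc; f_equal; apply bs_add_comm.
Qed.

Lemma pden_add p q : pden (poly_add p q) = pden p +' pden q.
Proof.
  induction p as [| m p IH]; simpl.
  - rewrite bs_add_zero; reflexivity.
  - unfold poly_add in *; rewrite pden_addm, IH, bs_add_assoc; reflexivity.
Qed.

Lemma wden_app u v : wden (u ++ v) = wden u *' wden v.
Proof.
  induction u; simpl.
  - rewrite mul_one_l; reflexivity.
  - rewrite IHu; apply bs_mul_assoc.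
Qed.

Lemma pden_mulm c w p : pden (poly_mulm c w p) = c *: (wden w *' pden p).
Proof.
  induction p as [| m p IH]; simpl.
  - rewrite mul_zero_r, scal_zero_r; reflexivity.
  - rewrite IH, wden_app, bs_mul_addr, bs_scal_addr, bs_mul_scalr,
      bs_scal_assoc; reflexivity.
Qed.

Lemma pden_mul p q : pden (poly_mul p q) = pden p *' pden q.
Proof.
  induction p as [| m p IH]; simpl.
  - rewrite mul_zero_l; reflexivity.
  - rewrite pden_add, pden_mulm, IH, bs_mul_addl, bs_mul_scall; reflexivity.
Qed.

Lemma poly_of_correct x : pden (poly_of x) = aden x.
Proof.
  induction x; simpl;
    rewrite ?pden_add, ?pden_mulm, ?pden_mul, ?IHx1, ?IHx2, ?IHx; simpl;
    rewrite ?mul_one_r, ?mul_one_l, ?add_zero_r, ?bs_scal_one; auto.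
  - unfold bs_sub; rewrite <- opp_scal; reflexivity.
  - rewrite <- opp_scal; reflexivity.
Qed.

Lemma poly_null_correct p : poly_null p -> pden p = bs_zero.
Proof.
  induction p as [| [c w] p IH]; simpl; auto.
  intros [-> H]; rewrite IH, scal_zero_l, bs_add_zero; auto.
Qed.

Lemma aexp_eq x y : poly_null (poly_of (ASub x y)) -> aden x = aden y.
Proof.
  intro H; apply poly_null_correct in H; rewrite poly_of_correct in H; simpl in H.
  apply (add_cancel_l _ (bs_opp (aden y))); rewrite bs_add_opp, bs_add_comm; exact H.
Qed.
End Denote.

Ltac mem_pos x l :=
  lazymatch l with
  | x :: _ => constr:(O)
  | _ :: ?l' => let n := mem_pos x l' in constr:(S n)
  end.
Ltac in_env x l :=
  lazymatch l with
  | nil => constr:(false)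
  | x :: _ => constr:(true)
  | _ :: ?l' => in_env x l'
  end.
Ltac collect l t :=
  lazymatch t with
  | bs_add ?x ?y => let l := collect l x in collect l y
  | bs_sub _ ?x ?y => let l := collect l x in collect l y
  | bs_mul ?x ?y => let l := collect l x in collect l y
  | bs_opp ?x => collect l x
  | bs_scal _ ?x => collect l x
  | bs_zero => l
  | one => l
  | _ => lazymatch in_env t l with true => l | false => constr:(t :: l) end
  end.
Ltac reify l t :=
  lazymatch t with
  | bs_add ?x ?y => let a := reify l x in let b := reify l y in constr:(AAdd a b)
  | bs_sub _ ?x ?y => let a := reify l x in let b := reify l y in constr:(ASub a b)
  | bs_mul ?x ?y => let a := reify l x in let b := reify l y in constr:(AMul a b)
  | bs_opp ?x => let a := reify l x in constr:(AOpp a)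
  | bs_scal ?c ?x => let a := reify l x in constr:(AScal c a)
  | bs_zero => constr:(AZero)
  | one => constr:(AOne)
  | _ => let n := mem_pos t l in constr:(AVar n)
  end.
Ltac alg_with tac :=
  lazymatch goal with
  | |- @eq (bs_car (ub_alg ?U)) ?x ?y =>
      let l := collect (@nil (bs_car (ub_alg U))) x in
      let l := collect l y in
      let a := reify l x in
      let b := reify l y in
      change (aden U l a = aden U l b);
      apply aexp_eq;
      cbn [poly_of poly_add poly_addm poly_mulm poly_mul poly_null word_eqb Nat.eqb andb
           fst snd map app fold_right];
      repeat split; tac
  end.
Ltac alg := alg_with ltac:(try solve [creal]).

(** [alg] takes every adjoint as an atom, so the involution is first pushed down to the atoms. *)
Ltac stars := repeat (rewrite star_sub || rewrite bs_star_add || rewrite bs_star_mul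
  || rewrite bs_star_scal || rewrite star_opp || rewrite bs_star_star).
(** * Invertible elements and the spectral radius *)

Section Unital.
Variable U : UnitalBanachStarAlgebra.
Implicit Types x y z a b g h : U.

Lemma star_one : (one : U)^* = one.
Proof.
  transitivity ((one *' (one : U)^*)^*).
  - rewrite bs_star_mul, bs_star_star, mul_one_l; auto.
  - rewrite mul_one_l; apply bs_star_star.
Qed.

Lemma norm_scal_one (c : Cpx) : bs_norm (c *: (one : U)) = Cmod c.
Proof. rewrite bs_norm_scal, norm_one; ring. Qed.

Lemma sub_eq_zero x y : x -' y = bs_zero -> x = y.
Proof. intro H; replace x with (x -' y +' y) by alg; rewrite H; alg. Qed.

Lemma norm_sub_sym x y : bs_norm (x -' y) = bs_norm (y -' x).
Proof. rewrite <- norm_opp; f_equal; alg. Qed.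

Lemma norm_le_sub x y : bs_norm x <= bs_norm y + bs_norm (x -' y).
Proof.
  replace x with (y +' (x -' y)) at 1 by alg; apply bs_norm_triangle.
Qed.

Lemma norm_mul3 x y z : bs_norm (x *' y *' z) <= bs_norm x * bs_norm y * bs_norm z.
Proof.
  eapply Rle_trans; [apply bs_norm_mul |].
  apply Rmult_le_compat_r; [apply bs_norm_nonneg | apply bs_norm_mul].
Qed.

Definition inverse_of x y := x *' y = one /\ y *' x = one.
Definition invertible x := exists y, inverse_of x y.

Lemma inverse_left_right x y z : y *' x = one -> x *' z = one -> inverse_of x y.
Proof.
  intros Hl Hr; split; auto.
  replace y with z; auto.
  transitivity (y *' x *' z); [rewrite Hl; alg |].
  rewrite <- bs_mul_assoc, Hr; alg.
Qed.

Lemma inverse_unique x y z : inverse_of x y -> inverse_of x z -> y = z.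
Proof.
  intros [_ Hl] [Hr _].
  transitivity (y *' (x *' z)); [rewrite Hr; alg |].
  rewrite bs_mul_assoc, Hl; alg.
Qed.

Lemma invertible_mul x y : invertible x -> invertible y -> invertible (x *' y).
Proof.
  intros [x' [H1 H2]] [y' [H3 H4]]; exists (y' *' x'); split.
  - transitivity (x *' (y *' y') *' x'); [alg |]; rewrite H3, mul_one_r; auto.
  - transitivity (y' *' (x' *' x) *' y); [alg |]; rewrite H2, mul_one_r; auto.
Qed.

Lemma invertible_factor x l r : invertible (l *' x) -> invertible (x *' r) -> invertible x.
Proof.
  intros [y [_ H1]] [z [H2 _]].
  exists (y *' l); apply inverse_left_right with (r *' z).
  - rewrite <- bs_mul_assoc; auto.
  - rewrite bs_mul_assoc; auto.
Qed.

Lemma invertible_commuting_factor x y : x *' y = y *' x -> invertible (x *' y) -> invertible x.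
Proof. intros H Hi; apply invertible_factor with y y; [rewrite <- H |]; auto. Qed.

Lemma invertible_scal c x : c <> C0 -> invertible x -> invertible (c *: x).
Proof.
  intros Hc [y [H1 H2]]; exists (Cinv c *: y).
  split; rewrite bs_mul_scall, bs_mul_scalr, bs_scal_assoc, ?H1, ?H2.
  - rewrite Cmul_inv, bs_scal_one; auto.
  - rewrite Cinv_mul, bs_scal_one; auto.
Qed.

Lemma invertible_scal_eq c x y : c <> C0 -> y = c *: x -> invertible x -> invertible y.
Proof. intros Hc -> ; apply invertible_scal; auto. Qed.

Lemma inverse_star x y : inverse_of x y -> inverse_of x^* y^*.
Proof.
  intros [H1 H2]; split; rewrite <- bs_star_mul, ?H1, ?H2; apply star_one.
Qed.

Lemma inverse_hermitian x y : x^* = x -> inverse_of x y -> y^* = y.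
Proof.
  intros Hx H; apply (inverse_unique x); auto.
  rewrite <- Hx; apply inverse_star; auto.
Qed.

Lemma inverse_commute x y z : inverse_of x y -> x *' z = z *' x -> y *' z = z *' y.
Proof.
  intros [H1 H2] H.
  transitivity (y *' (z *' x) *' y).
  - rewrite <- !bs_mul_assoc, H1, mul_one_r; auto.
  - rewrite <- H, bs_mul_assoc, H2, mul_one_l; auto.
Qed.

(* Jacobson: if [w] inverts [c - xy] then [(1 + y w x) / c] inverts [c - yx]. *)
Lemma invertible_swap c x y :
  c <> C0 -> invertible (c *: one -' x *' y) -> invertible (c *: one -' y *' x).
Proof.
  intros Hc [w [H1 H2]].
  assert (E1 : c *: w = one +' x *' y *' w) by (rewrite <- H1; alg).
  assert (E2 : c *: w = one +' w *' x *' y) by (rewrite <- H2; alg).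
  apply (invertible_commuting_factor _ (one +' y *' w *' x)).
  - transitivity (c *: one : U).
    + transitivity (c *: one +' y *' (c *: w) *' x -' y *' x -' y *' (x *' y *' w) *' x);
        [alg |]. rewrite E1; alg.
    + transitivity (c *: one +' y *' (c *: w) *' x -' y *' x -' y *' (w *' x *' y) *' x);
        [| alg]. rewrite E2; alg.
  - exists (Cinv c *: one); split.
    + transitivity (Cinv c *: (c *: one +' y *' (c *: w) *' x -' y *' x -' y *' (x *' y *' w) *' x));
        [alg |]. rewrite E1.
      transitivity (Cmul c (Cinv c) *: (one : U)); [alg |].
      rewrite Cmul_inv; auto; alg.
    + transitivity (Cinv c *: (c *: one +' y *' (c *: w) *' x -' y *' x -' y *' (x *' y *' w) *' x));
        [alg |]. rewrite E1.
      transitivity (Cmul c (Cinv c) *: (one : U)); [alg |].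
      rewrite Cmul_inv; auto; alg.
Qed.

(** * Powers and elements of spectral radius below one *)

Fixpoint pw x (n : nat) : U := match n with O => one | S n => x *' pw x n end.
(** The power x^(2^k), computed by squaring the argument, so that an induction on [k] applies its
    hypothesis to [x *' x]; [sqi_S] gives the squaring on the outside. *)
Fixpoint sqi (k : nat) x : U := match k with O => x | S k => sqi k (x *' x) end.

Lemma pw_add x m n : pw x (m + n) = pw x m *' pw x n.
Proof.
  induction m; simpl; [rewrite mul_one_l; auto |].
  rewrite IHm; apply bs_mul_assoc.
Qed.

Lemma pw_S_r x n : pw x (S n) = pw x n *' x.
Proof. replace (S n) with (n + 1)%nat by lia; rewrite pw_add; simpl; rewrite mul_one_r; auto. Qed.

Lemma pw_sq x n : pw (x *' x) n = pw x (2 * n).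
Proof.
  induction n; simpl; auto.
  rewrite IHn; replace (n + S (n + 0))%nat with (S (2 * n)) by lia; simpl.
  symmetry; apply bs_mul_assoc.
Qed.

Lemma sqi_pw k x : sqi k x = pw x (2 ^ k).
Proof.
  revert x; induction k; intro x; simpl; [rewrite mul_one_r; auto |].
  rewrite IHk, pw_sq; f_equal.
Qed.

Lemma sqi_S k x : sqi (S k) x = sqi k x *' sqi k x.
Proof. rewrite !sqi_pw, <- pw_add; f_equal; simpl; lia. Qed.

Lemma pw_scal c x n : exists d, Cmod d = Cmod c ^ n /\ pw (c *: x) n = d *: pw x n.
Proof.
  induction n as [| n [d [H1 H2]]]; simpl.
  - exists C1; split; [apply Cmod_unique; simpl; lra | rewrite bs_scal_one; auto].
  - exists (Cmul c d); split; [rewrite Cmod_mul, H1; auto |].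
    rewrite H2; alg.
Qed.

Lemma pw_swap x y n : pw (y *' x) (S n) = y *' pw (x *' y) n *' x.
Proof.
  induction n; [simpl; alg |].
  change (y *' x *' pw (y *' x) (S n) = y *' pw (x *' y) (S n) *' x).
  rewrite IHn; simpl; alg.
Qed.

(* [small x] says that the spectral radius of [x] is less than one. *)
Definition small x :=
  exists C q, 0 < C /\ 0 < q < 1 /\ forall n, bs_norm (pw x n) <= C * q ^ n.

Lemma small_norm x : bs_norm x < 1 -> small x.
Proof.
  intro H; pose proof (bs_norm_nonneg _ x).
  exists 1, ((bs_norm x + 1) / 2); repeat split; try lra.
  induction n; simpl; [rewrite norm_one; lra |].
  eapply Rle_trans; [apply bs_norm_mul |].
  rewrite Rmult_1_l in *.
  apply Rmult_le_compat; try apply bs_norm_nonneg; lra.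
Qed.

(** The rate becomes [sqrt q]; an odd power has one more factor [x], whose norm goes into the
    constant. *)
Lemma small_sq x : small (x *' x) -> small x.
Proof.
  intros (C & q & HC & Hq & H).
  pose proof (bs_norm_nonneg _ x) as Hx.
  assert (Hs : 0 < sqrt q) by (apply sqrt_lt_R0; lra).
  assert (Hss : sqrt q * sqrt q = q) by (apply sqrt_sqrt; lra).
  set (K := bs_norm x / sqrt q).
  assert (HK : 0 <= K) by (apply Rmult_le_pos; [| left; apply Rinv_0_lt_compat]; lra).
  assert (HKq : K * sqrt q = bs_norm x) by (unfold K; field; lra); clearbody K.
  exists (C * (1 + K)), (sqrt q); repeat split; try nra.
  intro n; destruct (Nat.Even_or_Odd n) as [[m ->] | [m ->]].
  - rewrite <- pw_sq; specialize (H m).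
    replace (sqrt q ^ (2 * m)) with (q ^ m) by (rewrite pow_mult; f_equal; simpl; lra).
    pose proof (pow_lt q m ltac:(lra)).
    assert (0 <= C * q ^ m * K) by (repeat apply Rmult_le_pos; lra).
    nra.
  - rewrite Nat.add_1_r; cbn [pw]; rewrite <- pw_sq.
    eapply Rle_trans; [apply bs_norm_mul |].
    specialize (H m).
    replace (sqrt q ^ S (2 * m)) with (sqrt q * q ^ m)
      by (change (sqrt q ^ S (2 * m)) with (sqrt q * sqrt q ^ (2 * m));
          rewrite pow_mult; f_equal; f_equal; simpl; lra).
    pose proof (pow_lt q m ltac:(lra)).
    eapply Rle_trans; [apply Rmult_le_compat_l; [auto | exact H] |].
    rewrite <- HKq.
    assert (0 <= C * q ^ m * sqrt q) by (repeat apply Rmult_le_pos; lra).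
    nra.
Qed.

(** With [small_norm], a single power x^(2^k) of norm below one makes [x] small. *)
Lemma small_of_sqi k x : small (sqi k x) -> small x.
Proof. revert x; induction k; intros x H; auto; apply small_sq, IHk, H. Qed.

Lemma small_eventually x eps :
  small x -> 0 < eps -> exists n0, forall n, (n0 <= n)%nat -> bs_norm (pw x n) < eps.
Proof.
  intros (C & q & HC & Hq & H) He.
  destruct (pow_lt_1_zero q) with (y := eps / C) as [n0 Hn0].
  - rewrite Rabs_pos_eq; lra.
  - apply Rdiv_lt_0_compat; auto.
  - exists n0; intros n Hn; eapply Rle_lt_trans; [apply H |].
    specialize (Hn0 n Hn); rewrite Rabs_pos_eq in Hn0 by (apply pow_le; lra).
    apply (Rmult_lt_compat_l C) in Hn0; auto.
    replace (C * (eps / C)) with eps in Hn0 by (field; lra); auto.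
Qed.

Lemma small_sqi_eventually x eps :
  small x -> 0 < eps -> exists k0, forall k, (k0 <= k)%nat -> bs_norm (sqi k x) < eps.
Proof.
  intros H He; destruct (small_eventually x eps H He) as [n0 H0].
  exists n0; intros k Hk; rewrite sqi_pw; apply H0.
  pose proof (Nat.pow_gt_lin_r 2 k); lia.
Qed.

(** By [pw_swap], (y x)^(n+1) = y (x y)^n x, which has norm below one for large n. This is the
    counterpart of r(x y) = r(y x). *)
Lemma small_swap x y : small (x *' y) -> small (y *' x).
Proof.
  intro H.
  set (M := 1 + bs_norm y * bs_norm x).
  pose proof (bs_norm_nonneg _ x); pose proof (bs_norm_nonneg _ y).
  assert (HM : 0 < M) by (unfold M; nra).
  destruct (small_eventually _ (/ M) H) as [n0 Hn0]; [apply Rinv_0_lt_compat; auto |].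
  apply small_of_sqi with (S n0), small_norm; rewrite sqi_pw.
  pose proof (Nat.pow_gt_lin_r 2 (S n0) ltac:(lia)).
  destruct (2 ^ S n0)%nat as [| n] eqn:E; [lia |].
  rewrite pw_swap.
  eapply Rle_lt_trans; [apply norm_mul3 |].
  specialize (Hn0 n ltac:(lia)).
  apply Rmult_lt_compat_l with (r := M) in Hn0; auto.
  rewrite Rinv_r in Hn0 by lra.
  pose proof (bs_norm_nonneg _ (pw (x *' y) n)); unfold M in Hn0; nra.
Qed.

Lemma small_scal_le c x : Cmod c <= 1 -> small x -> small (c *: x).
Proof.
  intros Hc (C & q & HC & Hq & H); exists C, q; repeat split; try lra.
  intro n; destruct (pw_scal c x n) as (d & Hd & ->).
  rewrite bs_norm_scal, Hd.
  assert (0 <= Cmod c ^ n <= 1).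
  { split; [apply pow_le, Cmod_ge0 |].
    rewrite <- (pow1 n); apply pow_incr; split; [apply Cmod_ge0 | auto]. }
  specialize (H n); pose proof (bs_norm_nonneg _ (pw x n)); nra.
Qed.

(** * Completeness and the Neumann series *)

Definition converges (u : nat -> U) l :=
  forall eps, 0 < eps -> exists N, forall n, (N <= n)%nat -> bs_norm (u n -' l) < eps.

(** Method of majorants: the increments of a bounded increasing real sequence dominate those of [u].
    It serves the Neumann series and the iteration behind the square root. *)
Lemma converges_of_majorant (u : nat -> U) (r : nat -> R) (B : R) :
  (forall n, bs_norm (u (S n) -' u n) <= r (S n) - r n) -> (forall n, r n <= B) ->
  exists l, converges u l.
Proof.
  intros Hu HB.
  assert (Hr : Un_growing r).
  { intro n; pose proof (bs_norm_nonneg _ (u (S n) -' u n)); specialize (Hu n); lra. }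
  assert (Hd : forall n k, bs_norm (u (n + k)%nat -' u n) <= r (n + k)%nat - r n).
  { intros n k; induction k.
    - rewrite Nat.add_0_r.
      replace (u n -' u n) with (bs_zero : U) by alg; rewrite norm_zero; lra.
    - rewrite Nat.add_succ_r.
      replace (u (S (n + k)) -' u n)
        with ((u (S (n + k)) -' u (n + k)%nat) +' (u (n + k)%nat -' u n)) by alg.
      eapply Rle_trans; [apply bs_norm_triangle |].
      specialize (Hu (n + k)%nat); lra. }
  assert (Hcv : {l | Un_cv r l}).
  { apply growing_cv; auto; exists B; intros x [n ->]; auto. }
  destruct Hcv as [l Hl].
  pose proof (growing_ineq r l Hr Hl) as Hle.
  apply (bs_complete _ u).
  intros eps He; destruct (Hl (eps / 2)) as [N HN]; [lra |].
  exists N.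
  assert (HNN : forall n, (N <= n)%nat -> bs_norm (u n -' u N) < eps / 2).
  { intros n Hn; replace n with (N + (n - N))%nat by lia.
    eapply Rle_lt_trans; [apply Hd |].
    specialize (HN N (le_n _)); unfold Rdist in HN; apply Rabs_def2 in HN.
    specialize (Hle (N + (n - N))%nat); lra. }
  intros m n Hm Hn; change (bs_norm (u m -' u n) < eps).
  replace (u m -' u n) with ((u m -' u N) -' (u n -' u N)) by alg.
  eapply Rle_lt_trans; [apply norm_sub_le |].
  pose proof (HNN m Hm); pose proof (HNN n Hn); lra.
Qed.

Lemma limit_unique (x y : U) :
  (forall eps, 0 < eps -> bs_norm (x -' y) < eps) -> x = y.
Proof.
  intro H; apply sub_eq_zero, bs_norm_eq0.
  pose proof (bs_norm_nonneg _ (x -' y)).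
  apply Rle_antisym; auto; apply Rnot_lt_le; intro.
  specialize (H (bs_norm (x -' y))); lra.
Qed.

Lemma neumann x : bs_norm x < 1 ->
  exists y, inverse_of (one -' x) y /\ bs_norm y <= / (1 - bs_norm x).
Proof.
  intro Hx; pose proof (bs_norm_nonneg _ x) as H0.
  set (t := bs_norm x) in *.
  pose (u := fix u n : U := match n with O => one | S n => one +' x *' u n end).
  (* The geometric sum 1 + t + ... + t^n. *)
  pose (r := fun n => (1 - t ^ (S n)) / (1 - t)).
  assert (Hpw : forall n, bs_norm (pw x n) <= t ^ n).
  { induction n; simpl; [rewrite norm_one; lra |].
    eapply Rle_trans; [apply bs_norm_mul |].
    apply Rmult_le_compat; auto; try apply bs_norm_nonneg; unfold t; lra. }
  assert (Hu : forall n, u (S n) -' u n = pw x (S n)).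
  { induction n; [simpl; alg |].
    change (u (S (S n))) with (one +' x *' u (S n)).
    replace (one +' x *' u (S n) -' u (S n)) with (x *' (u (S n) -' u n))
      by (change (u (S n)) with (one +' x *' u n); alg).
    rewrite IHn; auto. }
  assert (Hux : forall n, u n *' x = x *' u n).
  { induction n; simpl; [alg |]. transitivity (x +' x *' (u n *' x)); [alg |].
    rewrite IHn; alg. }
  destruct (converges_of_majorant u r (/ (1 - t))) as [l Hl].
  - intro n; rewrite Hu; eapply Rle_trans; [apply Hpw |].
    unfold r; right; simpl; field; lra.
  - intro n; unfold r, Rdiv; pose proof (pow_le t (S n) H0).
    assert (0 < / (1 - t)) by (apply Rinv_0_lt_compat; lra); nra.
  - assert (Hfix : l = one +' x *' l).
    { apply limit_unique; intros eps He.
      destruct (Hl (eps / 3)) as [N HN]; [lra |].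
      replace (l -' (one +' x *' l)) with
        (bs_opp (u (S N) -' l) +' x *' (u N -' l)) by (cbn [u]; alg).
      eapply Rle_lt_trans; [apply bs_norm_triangle |]; rewrite norm_opp.
      pose proof (HN (S N) ltac:(lia)); pose proof (HN N ltac:(lia)).
      pose proof (bs_norm_mul _ x (u N -' l)); fold t in H2.
      pose proof (bs_norm_nonneg _ (u N -' l)); nra. }
    assert (Hcomm : l *' x = x *' l).
    { apply limit_unique; intros eps He.
      destruct (Hl (eps / 3)) as [N HN]; [lra |].
      replace (l *' x -' x *' l) with (x *' (u N -' l) -' (u N -' l) *' x)
        by (transitivity (l *' x -' x *' l +' (x *' u N -' u N *' x)); [alg |];
            rewrite Hux; alg).
      eapply Rle_lt_trans; [apply norm_sub_le |].
      pose proof (HN N ltac:(lia)).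
      pose proof (bs_norm_mul _ x (u N -' l)); pose proof (bs_norm_mul _ (u N -' l) x).
      fold t in H1, H2; pose proof (bs_norm_nonneg _ (u N -' l)); nra. }
    exists l; split; [split |].
    + transitivity (l -' x *' l); [alg |]; rewrite Hfix at 1; alg.
    + transitivity (l -' l *' x); [alg |]; rewrite Hcomm, Hfix at 1; alg.
    + assert (bs_norm l <= 1 + t * bs_norm l).
      { rewrite Hfix at 1; eapply Rle_trans; [apply bs_norm_triangle |].
        rewrite norm_one; pose proof (bs_norm_mul _ x l); fold t in H; lra. }
      apply Rmult_le_reg_r with (1 - t); [lra |]; rewrite Rinv_l by lra; lra.
Qed.

(** Neumann's series inverts 1 - x^(2^k) for large k, and 1 - x^2 = (1 - x)(1 + x) has commuting
    factors, so invertibility descends to 1 - x. *)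
Lemma small_invertible x : small x -> invertible (one -' x).
Proof.
  intro Hs; destruct (small_sqi_eventually x 1 Hs) as [k Hk]; [lra |].
  specialize (Hk k (le_n _)); clear Hs.
  assert (Hi : invertible (one -' sqi k x)) by (destruct (neumann _ Hk) as (y & H & _); exists y; auto).
  clear Hk; revert x Hi; induction k; intros x Hi; auto.
  apply IHk in Hi.
  apply (invertible_commuting_factor _ (one +' x)); [alg |].
  replace ((one -' x) *' (one +' x)) with (one -' x *' x) by alg; auto.
Qed.

End Unital.

(** * From invertibility on the unit disc to decay of powers, without complex analysis *)

Section SpectralRadius.
Variable U : UnitalBanachStarAlgebra.
Implicit Types x y z a b g h p : U.

(** One has x' = x (1 - y (x - x')), and Neumann's series inverts the second factor with an inverse
    of norm at most 2. *)
Lemma inverse_perturbation x y (x' : U) :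
  inverse_of U x y -> bs_norm (x' -' x) * bs_norm y <= 1 / 2 ->
  exists y', inverse_of U x' y' /\ bs_norm y' <= 2 * bs_norm y.
Proof.
  intros [H1 H2] Hn.
  assert (Hy : bs_norm (y *' (x -' x')) <= 1 / 2).
  { eapply Rle_trans; [apply bs_norm_mul |]; rewrite norm_sub_sym; lra. }
  destruct (neumann U (y *' (x -' x'))) as (w & [H3 H4] & Hw); [lra |].
  exists (w *' y); split.
  - assert (E : y *' x' = one -' y *' (x -' x')).
    { transitivity (y *' x' +' one -' y *' x); [rewrite H2; alg | alg]. }
    apply inverse_left_right with (w *' y).
    + rewrite <- bs_mul_assoc, E; auto.
    + transitivity (x *' (y *' x') *' (w *' y)).
      * transitivity (x *' y *' (x' *' (w *' y))); [rewrite H1; alg | alg].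
      * rewrite E; transitivity (x *' ((one -' y *' (x -' x')) *' w) *' y); [alg |].
        rewrite H3, mul_one_r; auto.
  - eapply Rle_trans; [apply bs_norm_mul |].
    apply Rmult_le_compat_r; [apply bs_norm_nonneg |].
    eapply Rle_trans; [exact Hw |].
    rewrite <- (Rinv_inv 2); apply Rinv_le_contravar; lra.
Qed.

Lemma resolvent_bounded a :
  (forall c, Cmod c <= 1 -> invertible U (one -' c *: a)) ->
  exists M, 0 < M /\ forall c, Cmod c <= 1 ->
    exists y, inverse_of U (one -' c *: a) y /\ bs_norm y <= M.
Proof.
  intro H.
  (* The same [d] is the radius of a neighbourhood and the reciprocal of a bound on it, because
     compactness returns one positive lower bound for all the radii used. *)
  assert (Hloc : forall u v, exists d : posreal, forall c,
    Rabs (Cre c - u) < d -> Rabs (Cim c - v) < d -> Cmod c <= 1 ->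
    exists y, inverse_of U (one -' c *: a) y /\ bs_norm y <= / d).
  { intros u v.
    assert (Hdist : forall (d : R) c, Rabs (Cre c - u) < d -> Rabs (Cim c - v) < d ->
              Cmod (Cadd c (Copp (mkC u v))) <= 2 * d).
    { intros d c Hr Hi; eapply Rle_trans; [apply Cmod_le_abs |].
      simpl; unfold Rminus in *; lra. }
    destruct (Rle_lt_dec (Cmod (mkC u v)) 1) as [Hin | Hout].
    - destruct (H _ Hin) as [y Hy].
      pose proof (bs_norm_nonneg _ a) as Ha; pose proof (bs_norm_nonneg _ y) as Hny.
      (* Within 1/K the perturbation times the norm of [y] is at most 1/2, and the resulting bound,
         twice the norm of [y], is at most [K]. *)
      set (K := 4 * (1 + bs_norm a) * (1 + bs_norm y)).
      assert (HK : 0 < K) by (unfold K; nra).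
      exists (mkposreal _ (Rinv_0_lt_compat _ HK)); simpl.
      intros c Hr Hi _.
      destruct (inverse_perturbation _ y (one -' c *: a) Hy) as (y' & H1 & H2).
      + replace (one -' c *: a -' (one -' mkC u v *: a))
          with (bs_opp (Cadd c (Copp (mkC u v)) *: a)) by alg.
        rewrite norm_opp, bs_norm_scal.
        pose proof (Hdist _ c Hr Hi) as Hd.
        assert (HKK : / K * K = 1) by (field; lra).
        assert (0 < / K) by (apply Rinv_0_lt_compat; lra).
        assert (2 * / K * (bs_norm a * bs_norm y) <= 1 / 2).
        { assert (/ K * (4 * (bs_norm a * bs_norm y)) <= / K * K); [| lra].
          apply Rmult_le_compat_l; [lra |]; unfold K; nra. }
        assert (0 <= bs_norm a * bs_norm y) by nra.
        rewrite Rmult_assoc.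
        eapply Rle_trans; [apply Rmult_le_compat_r; [auto | exact Hd] | auto].
      + exists y'; split; auto.
        rewrite Rinv_inv; unfold K; nra.
    (* Outside the disc the neighbourhood is taken so small that it misses the disc, and the claim
       there is vacuous. *)
    - assert (Hp : 0 < (Cmod (mkC u v) - 1) / 2) by lra.
      exists (mkposreal _ Hp); simpl.
      intros c Hr Hi Hc; exfalso.
      assert (Hlt : exists d, d < (Cmod (mkC u v) - 1) / 2 /\
                Rabs (Cre c - u) < d /\ Rabs (Cim c - v) < d).
      { set (m := Rmax (Rabs (Cre c - u)) (Rabs (Cim c - v))).
        assert (m < (Cmod (mkC u v) - 1) / 2) by (apply Rmax_lub_lt; auto).
        pose proof (Rmax_l (Rabs (Cre c - u)) (Rabs (Cim c - v))).
        pose proof (Rmax_r (Rabs (Cre c - u)) (Rabs (Cim c - v))).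
        exists ((m + (Cmod (mkC u v) - 1) / 2) / 2); fold m in H1, H2; repeat split; lra. }
      destruct Hlt as (d & Hd & Hr' & Hi').
      pose proof (Hdist d c Hr' Hi') as Hd2.
      pose proof (Cmod_triangle c (Copp (Cadd c (Copp (mkC u v))))) as Ht.
      rewrite Cmod_opp in Ht.
      replace (Cadd c (Copp (Cadd c (Copp (mkC u v))))) with (mkC u v) in Ht by creal.
      lra. }
  pose (delta := fun u v => proj1_sig (constructive_indefinite_description _ (Hloc u v))).
  destruct (compactness_value_2d (-1) 1 (-1) 1 delta) as [d Hd].
  exists (/ d); split; [apply Rinv_0_lt_compat, cond_pos |].
  intros c Hc.
  pose proof (Cmod_re c) as Hre; pose proof (Cmod_im c) as Him.
  assert (Hre' : Rabs (Cre c) <= 1) by lra; assert (Him' : Rabs (Cim c) <= 1) by lra.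
  apply Rabs_le_between in Hre'; apply Rabs_le_between in Him'.
  specialize (Hd (Cre c) (Cim c) Hre' Him'); apply NNPP in Hd.
  destruct Hd as (u & v & _ & _ & H1 & H2 & H3).
  unfold delta in *; destruct (constructive_indefinite_description _ (Hloc u v)) as [e He].
  simpl in *; destruct (He c H1 H2 Hc) as (y & Hy & Hn).
  exists y; split; auto; eapply Rle_trans; [exact Hn |].
  apply Rinv_le_contravar; auto; apply cond_pos.
Qed.

(** Closeness is measured on resolvents over the whole unit circle because this survives squaring
    with the same [d], which a bound on [p -' p'] would not. *)
Definition resolvents_close (d : R) p (p' : U) :=
  forall w, Cmod w = 1 -> exists y y',
    inverse_of U (one -' w *: p) y /\ inverse_of U (one -' w *: p') y' /\
    bs_norm (y -' y') <= d.

(** Partial fractions: the average of the two inverses equals their product in either order. *)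
Lemma inverse_average x y z :
  inverse_of U (one -' x) y -> inverse_of U (one +' x) z ->
  inverse_of U (one -' x *' x) (RtoC (/ 2) *: (y +' z)).
Proof.
  intros [H1 H2] [H3 H4].
  assert (E : RtoC (/ 2) *: (y +' z) = y *' z).
  { transitivity (RtoC (/ 2) *: (y *' ((one +' x) *' z) +' (y *' (one -' x)) *' z));
      [rewrite H2, H3; alg | alg]. }
  assert (E' : RtoC (/ 2) *: (y +' z) = z *' y).
  { transitivity (RtoC (/ 2) *: (z *' ((one -' x) *' y) +' (z *' (one +' x)) *' y));
      [rewrite H1, H4; alg | alg]. }
  split.
  - rewrite E; transitivity ((one +' x) *' ((one -' x) *' y) *' z); [alg |].
    rewrite H1; rewrite mul_one_r; auto.
  - rewrite E'; transitivity (z *' (y *' (one -' x)) *' (one +' x)); [alg |].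
    rewrite H2, mul_one_r; auto.
Qed.

Lemma resolvents_close_sq d p (p' : U) :
  resolvents_close d p p' -> resolvents_close d (p *' p) (p' *' p').
Proof.
  intros H w Hw; destruct (Csqrt_unit w Hw) as (s & Hs & <-).
  destruct (H s Hs) as (y1 & y1' & H1 & H1' & Hd1).
  destruct (H (Copp s)) as (y2 & y2' & H2 & H2' & Hd2); [rewrite Cmod_opp; auto |].
  exists (RtoC (/ 2) *: (y1 +' y2)), (RtoC (/ 2) *: (y1' +' y2')).
  assert (E : forall q : U, one -' Copp s *: q = one +' s *: q) by (intro; alg).
  assert (E' : forall q : U, one -' Cmul s s *: (q *' q) = one -' (s *: q) *' (s *: q))
    by (intro; alg).
  rewrite E in H2, H2'; rewrite !E'.
  split; [| split]; try (apply inverse_average; auto).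
  replace (RtoC (/ 2) *: (y1 +' y2) -' RtoC (/ 2) *: (y1' +' y2'))
    with (RtoC (/ 2) *: ((y1 -' y1') +' (y2 -' y2'))) by alg.
  rewrite norm_scal_R by lra.
  pose proof (bs_norm_triangle _ (y1 -' y1') (y2 -' y2')); lra.
Qed.

Lemma resolvents_close_sqi d k p (p' : U) :
  resolvents_close d p p' -> resolvents_close d (sqi U k p) (sqi U k p').
Proof.
  revert p p'; induction k; intros p p' H; auto.
  apply IHk, resolvents_close_sq, H.
Qed.

(** After k squarings [P] has norm below 1/8, while the resolvents at 1 are still within 1/8. So y
    is within 1/7 of the unit, and y' within 1/7 + 1/8 = 15/56. *)
Lemma small_of_resolvents_close p (p' : U) :
  resolvents_close (1 / 8) p p' -> small U p -> small U p'.
Proof.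
  intros Hc Hs.
  destruct (small_sqi_eventually U p (1 / 8) Hs) as [k Hk]; [lra |].
  specialize (Hk k (le_n _)).
  destruct (resolvents_close_sqi _ k _ _ Hc C1) as (y & y' & H1 & [H2 _] & Hd).
  { apply Cmod_unique; simpl; lra. }
  rewrite bs_scal_one in H1, H2.
  apply small_of_sqi with k, small_norm.
  set (P := sqi U k p) in *; set (P' := sqi U k p') in *; clearbody P P'.
  assert (Hy : bs_norm y <= 8 / 7).
  { destruct (neumann U P) as (y0 & Hy0 & Hn); [lra |].
    rewrite (inverse_unique U _ _ _ H1 Hy0).
    eapply Rle_trans; [exact Hn |].
    replace (8 / 7) with (/ (7 / 8)) by field; apply Rinv_le_contravar; lra. }
  assert (Hy1 : bs_norm (y -' one) <= 1 / 7).
  { destruct H1 as [H1 _].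
    replace (y -' one) with (P *' y)
      by (transitivity (y -' (one -' P) *' y); [alg | rewrite H1; alg]).
    eapply Rle_trans; [apply bs_norm_mul |].
    pose proof (bs_norm_nonneg _ P); pose proof (bs_norm_nonneg _ y); nra. }
  assert (Hy2 : bs_norm (y' -' one) <= 15 / 56).
  { replace (y' -' one) with ((y -' one) -' (y -' y')) by alg.
    eapply Rle_trans; [apply norm_sub_le |]; lra. }
  (* A rewriting of (1 - P') y' = 1; it bounds the norm of P' by (15/56)/(1 - 15/56) = 15/41. *)
  assert (HP : P' = (y' -' one) -' P' *' (y' -' one)).
  { transitivity (y' -' one -' P' *' (y' -' one) +' (one -' (one -' P') *' y'));
      [alg | rewrite H2; alg]. }
  assert (bs_norm P' <= 15 / 56 + bs_norm P' * (15 / 56)); [| lra].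
  rewrite HP at 1; eapply Rle_trans; [apply norm_sub_le |].
  pose proof (bs_norm_mul _ P' (y' -' one)); pose proof (bs_norm_nonneg _ P').
  pose proof (bs_norm_nonneg _ (y' -' one)); nra.
Qed.

(* Rickart's elementary form of the spectral radius formula: averaging over 2^k-th roots of
   unity transfers the continuity of the resolvent of [a] to that of [a^(2^k)], so that
   smallness of [s a] propagates from [s = 0] to [s = 1] in steps of a fixed length. *)
Lemma small_of_resolvent a :
  (forall c, Cmod c <= 1 -> invertible U (one -' c *: a)) -> small U a.
Proof.
  intro H; destruct (resolvent_bounded a H) as (M & HM & Hb).
  pose proof (bs_norm_nonneg _ a) as Ha.
  (* A step of length 1/n changes the resolvent by at most M^2 |a| / n, which has to be at most
     1/8. *)
  destruct (INR_unbounded (8 * M * M * bs_norm a)) as [n0 Hn0].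
  pose (n := S n0).
  assert (Hn : 8 * M * M * bs_norm a <= INR n) by (unfold n; rewrite S_INR; lra).
  assert (Hn1 : 0 < INR n) by (apply lt_0_INR; unfold n; lia).
  assert (Hstep : forall s t, 0 <= s <= 1 -> 0 <= t <= 1 -> Rabs (s - t) <= / INR n ->
            resolvents_close (1 / 8) (RtoC s *: a) (RtoC t *: a)).
  { intros s t Hs Ht Hst w Hw.
    destruct (Hb (Cmul w (RtoC s))) as (y & Hy & Hny).
    { rewrite Cmod_mul, Hw, Cmod_pos_RtoC; lra. }
    destruct (Hb (Cmul w (RtoC t))) as (y' & Hy' & Hny').
    { rewrite Cmod_mul, Hw, Cmod_pos_RtoC; lra. }
    exists y, y'; rewrite !bs_scal_assoc; split; [auto | split; [auto |]].
    destruct Hy as [_ Hy], Hy' as [Hy' _].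
    (* The resolvent identity. *)
    replace (y -' y') with (Cmul w (RtoC (s - t)) *: (y *' a *' y')).
    2:{ transitivity (y *' ((one -' Cmul w (RtoC t) *: a) *' y') -'
                      (y *' (one -' Cmul w (RtoC s) *: a)) *' y');
          [alg | rewrite Hy, Hy'; alg]. }
    rewrite bs_norm_scal, Cmod_mul, Hw, Cmod_RtoC, Rmult_1_l.
    pose proof (norm_mul3 U y a y') as H3.
    pose proof (bs_norm_nonneg _ y); pose proof (bs_norm_nonneg _ y').
    assert (bs_norm y * bs_norm a * bs_norm y' <= M * M * bs_norm a).
    { replace (M * M * bs_norm a) with (M * bs_norm a * M) by ring.
      apply Rmult_le_compat; auto; [apply Rmult_le_pos; auto |].
      apply Rmult_le_compat_r; auto. }
    apply Rle_trans with (/ INR n * (M * M * bs_norm a)).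
    - apply Rmult_le_compat; try apply bs_norm_nonneg; try lra; apply Rabs_pos.
    - apply Rmult_le_reg_l with (INR n); auto.
      rewrite <- Rmult_assoc, Rinv_r by lra; lra. }
  assert (Hall : forall i, (i <= n)%nat -> small U (RtoC (INR i / INR n) *: a)).
  { induction i; intro Hi.
    - apply small_norm; simpl.
      rewrite norm_scal_R by (unfold Rdiv; lra); unfold Rdiv; lra.
    - apply small_of_resolvents_close with (RtoC (INR i / INR n) *: a); [| apply IHi; lia].
      pose proof (pos_INR i); pose proof (le_INR _ _ Hi) as Hle; rewrite S_INR in *.
      assert (Hd : INR i / INR n + / INR n = (INR i + 1) / INR n) by (field; lra).
      assert (0 <= INR i / INR n) by (apply Rdiv_le_0_compat; auto).
      assert (0 < / INR n) by (apply Rinv_0_lt_compat; auto).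
      assert ((INR i + 1) / INR n <= 1) by (apply Rle_div_l; lra).
      apply Hstep; try lra.
      rewrite Rabs_left; lra. }
  specialize (Hall n (le_n _)).
  replace (RtoC (INR n / INR n)) with C1 in Hall.
  - rewrite bs_scal_one in Hall; auto.
  - unfold Rdiv; rewrite Rinv_r by lra; reflexivity.
Qed.
End SpectralRadius.

(** * Ford's square root lemma *)

Section SquareRoot.
Variable U : UnitalBanachStarAlgebra.
Implicit Types x y z a b g h p : U.

Lemma converges_const x : converges U (fun _ => x) x.
Proof.
  intros eps He; exists O; intros n _.
  replace (x -' x) with (bs_zero : U) by alg; rewrite norm_zero; auto.
Qed.

Lemma converges_add (u v : nat -> U) x y :
  converges U u x -> converges U v y -> converges U (fun n => u n +' v n) (x +' y).
Proof.
  intros Hu Hv eps He.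
  destruct (Hu (eps / 2)) as [N HN]; [lra |]; destruct (Hv (eps / 2)) as [M HM]; [lra |].
  exists (N + M)%nat; intros n Hn.
  replace (u n +' v n -' (x +' y)) with ((u n -' x) +' (v n -' y)) by alg.
  eapply Rle_lt_trans; [apply bs_norm_triangle |].
  specialize (HN n ltac:(lia)); specialize (HM n ltac:(lia)); lra.
Qed.

Lemma converges_mul (u v : nat -> U) x y :
  converges U u x -> converges U v y -> converges U (fun n => u n *' v n) (x *' y).
Proof.
  intros Hu Hv eps He.
  set (K := 1 + bs_norm x + bs_norm y).
  pose proof (bs_norm_nonneg _ x) as Hx; pose proof (bs_norm_nonneg _ y) as Hy.
  set (e := Rmin 1 (eps / (2 * K))).
  assert (HK : 0 < K) by (unfold K; lra).
  assert (He' : 0 < e) by (apply Rmin_glb_lt; [lra | apply Rdiv_lt_0_compat; lra]).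
  assert (He1 : e <= 1) by apply Rmin_l.
  assert (HeK : e * K < eps).
  { assert (e <= eps / (2 * K)) by apply Rmin_r.
    apply Rmult_le_compat_r with (r := K) in H; [| lra].
    replace (eps / (2 * K) * K) with (eps / 2) in H by (field; lra); lra. }
  destruct (Hu e He') as [N HN]; destruct (Hv e He') as [M HM].
  exists (N + M)%nat; intros n Hn.
  specialize (HN n ltac:(lia)); specialize (HM n ltac:(lia)).
  replace (u n *' v n -' x *' y)
    with ((u n -' x) *' (v n -' y) +' x *' (v n -' y) +' (u n -' x) *' y) by alg.
  eapply Rle_lt_trans; [apply bs_norm_triangle |].
  pose proof (bs_norm_triangle _ ((u n -' x) *' (v n -' y)) (x *' (v n -' y))).
  pose proof (bs_norm_mul _ (u n -' x) (v n -' y)).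
  pose proof (bs_norm_mul _ x (v n -' y)); pose proof (bs_norm_mul _ (u n -' x) y).
  pose proof (bs_norm_nonneg _ (u n -' x)); pose proof (bs_norm_nonneg _ (v n -' y)).
  unfold K in HeK; nra.
Qed.

Lemma converges_unique (u : nat -> U) x y : converges U u x -> converges U u y -> x = y.
Proof.
  intros Hx Hy; apply limit_unique; intros eps He.
  destruct (Hx (eps / 2)) as [N HN]; [lra |]; destruct (Hy (eps / 2)) as [M HM]; [lra |].
  replace (x -' y) with ((u (N + M)%nat -' y) -' (u (N + M)%nat -' x)) by alg.
  eapply Rle_lt_trans; [apply norm_sub_le |].
  specialize (HN (N + M)%nat ltac:(lia)); specialize (HM (N + M)%nat ltac:(lia)); lra.
Qed.

Lemma converges_S (u : nat -> U) x : converges U u x -> converges U (fun n => u (S n)) x.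
Proof.
  intros H eps He; destruct (H eps He) as [N HN]; exists N; intros n Hn; apply HN; lia.
Qed.

Lemma norm_limit_le (u : nat -> U) x B :
  converges U u x -> (forall n, bs_norm (u n) <= B) -> bs_norm x <= B.
Proof.
  intros H HB; apply Rnot_lt_le; intro Hlt.
  destruct (H (bs_norm x - B)) as [N HN]; [lra |].
  specialize (HN N (le_n _)); specialize (HB N).
  pose proof (norm_le_sub U x (u N)); rewrite norm_sub_sym in H0; lra.
Qed.

(* Pairs [(f h, f q)] with [f] a polynomial with nonnegative real coefficients. *)
Inductive poly_pair h (q : R) : U -> R -> Prop :=
| poly_pair_one : poly_pair h q one 1
| poly_pair_var x r : poly_pair h q x r -> poly_pair h q (h *' x) (q * r)
| poly_pair_add x r y s :
    poly_pair h q x r -> poly_pair h q y s -> poly_pair h q (x +' y) (r + s)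
| poly_pair_scal t x r :
    0 <= t -> poly_pair h q x r -> poly_pair h q (RtoC t *: x) (t * r).

Lemma poly_pair_mul h q x r y s :
  poly_pair h q x r -> poly_pair h q y s -> poly_pair h q (x *' y) (r * s).
Proof.
  intros Hx Hy; induction Hx.
  - rewrite mul_one_l, Rmult_1_l; auto.
  - rewrite <- bs_mul_assoc, Rmult_assoc; apply poly_pair_var; auto.
  - rewrite bs_mul_addl, Rmult_plus_distr_r; apply poly_pair_add; auto.
  - rewrite bs_mul_scall, Rmult_assoc; apply poly_pair_scal; auto.
Qed.

Lemma poly_pair_pw h q x r n : poly_pair h q x r -> poly_pair h q (pw U x n) (r ^ n).
Proof. intro H; induction n; simpl; [constructor | apply poly_pair_mul; auto]. Qed.

(** The bounds C q^n are not multiplicative in [h]. The induction therefore carries an extra power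
    of [h] in front, so that [C] enters only once. *)
Lemma poly_pair_norm h q C x r : 0 <= C -> 0 <= q ->
  (forall n, bs_norm (pw U h n) <= C * q ^ n) -> poly_pair h q x r -> bs_norm x <= C * r.
Proof.
  intros HC Hq Hh Hx.
  enough (H : forall n, bs_norm (pw U h n *' x) <= C * q ^ n * r).
  { specialize (H O); simpl in H; rewrite mul_one_l in H; lra. }
  induction Hx; intro n.
  - rewrite mul_one_r, Rmult_1_r; auto.
  - rewrite bs_mul_assoc, <- pw_S_r.
    replace (C * q ^ n * (q * r)) with (C * q ^ S n * r) by (simpl; ring); auto.
  - rewrite bs_mul_addr; eapply Rle_trans; [apply bs_norm_triangle |].
    specialize (IHHx1 n); specialize (IHHx2 n); lra.
  - rewrite bs_mul_scalr, norm_scal_R by auto.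
    specialize (IHHx n); nra.
Qed.

(** The iterates of g -> (h + g^2)/2 and their increments are polynomials in [h] with nonnegative
    coefficients, hence majorized by the same iteration on the scalar [q], which stays in [0, q]
    because (q + q^2)/2 <= q. The limit inherits the bounds C q^n of [h], and 1 - g is a square root
    of 1 - h. *)
Lemma quadratic_fixpoint h : small U h ->
  exists g, small U g /\ RtoC 2 *: g = h +' g *' g.
Proof.
  intros (C & q & HC & Hq & Hh).
  pose (g := fix g k : U := match k with
    | O => bs_zero | S k => RtoC (1 / 2) *: (h +' g k *' g k) end).
  pose (r := fix r k : R := match k with O => 0 | S k => 1 / 2 * (q + r k * r k) end).
  assert (Hh1 : poly_pair h q h q).
  { replace h with (h *' one) at 2 by alg; replace q with (q * 1) at 2 by ring.
    apply poly_pair_var, poly_pair_one. }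
  assert (Hg : forall k, poly_pair h q (g k) (r k)).
  { induction k; simpl.
    - replace (bs_zero : U) with (RtoC 0 *: (one : U)) by alg.
      replace 0 with (0 * 1) at 2 by ring.
      apply poly_pair_scal; [lra | apply poly_pair_one].
    - apply poly_pair_scal; [lra |]; apply poly_pair_add; auto; apply poly_pair_mul; auto. }
  assert (Hd : forall k, poly_pair h q (g (S k) -' g k) (r (S k) - r k)).
  { induction k.
    - simpl; replace (RtoC (1 / 2) *: (h +' bs_zero *' bs_zero) -' bs_zero)
        with (RtoC (1 / 2) *: h) by alg.
      replace (1 / 2 * (q + 0 * 0) - 0) with (1 / 2 * q) by ring.
      apply poly_pair_scal; auto; lra.
    - replace (g (S (S k)) -' g (S k)) with
        (RtoC (1 / 2) *: ((g (S k) -' g k) *' g (S k) +' g k *' (g (S k) -' g k)))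
        by (change (g (S (S k))) with (RtoC (1 / 2) *: (h +' g (S k) *' g (S k)));
            transitivity (RtoC (1 / 2) *: (h +' g (S k) *' g (S k)) -'
                          RtoC (1 / 2) *: (h +' g k *' g k)); [alg | reflexivity]).
      replace (r (S (S k)) - r (S k)) with
        (1 / 2 * ((r (S k) - r k) * r (S k) + r k * (r (S k) - r k)))
        by (change (r (S (S k))) with (1 / 2 * (q + r (S k) * r (S k)));
            transitivity (1 / 2 * (q + r (S k) * r (S k)) - 1 / 2 * (q + r k * r k));
            [ring | reflexivity]).
      apply poly_pair_scal; [lra |].
      apply poly_pair_add; apply poly_pair_mul; auto. }
  assert (Hr : forall k, 0 <= r k <= q).
  { induction k; simpl; [lra |]; nra. }
  destruct (converges_of_majorant U g (fun k => C * r k) (C * q)) as [l Hl].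
  - intro k; rewrite <- Rmult_minus_distr_l.
    apply (poly_pair_norm h q); auto; lra.
  - intro k; apply Rmult_le_compat_l; [lra | apply Hr].
  - exists l; split.
    + exists C, q; repeat split; try lra.
      intro n; apply norm_limit_le with (fun k => pw U (g k) n).
      * induction n; simpl; [apply converges_const | apply converges_mul; auto].
      * intro k; apply Rle_trans with (C * r k ^ n).
        -- apply (poly_pair_norm h q); try lra; auto; apply poly_pair_pw; auto.
        -- apply Rmult_le_compat_l; [lra | apply pow_incr, Hr].
    + apply (converges_unique (fun k => RtoC 2 *: g (S k))).
      * intros eps He; destruct (converges_S _ _ Hl (eps / 2)) as [N HN]; [lra |].
        exists N; intros n Hn; specialize (HN n Hn).
        replace (RtoC 2 *: g (S n) -' RtoC 2 *: l) with (RtoC 2 *: (g (S n) -' l)) by alg.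
        rewrite norm_scal_R; lra.
      * assert (E : (fun k => RtoC 2 *: g (S k)) = (fun k => h +' g k *' g k)).
        { apply FunctionalExtensionality.functional_extensionality; intro k; simpl; alg. }
        rewrite E; apply converges_add; [apply converges_const | apply converges_mul; auto].
Qed.

(** No estimate on powers of [g] bounds those of its adjoint. Invertibility of 1 - c g does pass to
    adjoints, and the resolvent criterion turns it back into smallness. *)
Lemma small_star g : small U g -> small U g^*.
Proof.
  intro H; apply small_of_resolvent; intros c Hc.
  destruct (small_invertible U (Cconj c *: g)) as [y Hy].
  - apply small_scal_le; auto; rewrite Cmod_conj; auto.
  - exists y^*; apply inverse_star in Hy.
    rewrite star_sub, star_one, bs_star_scal in Hy.
    replace (Cconj (Cconj c)) with c in Hy by creal; auto.
Qed.

(* From [2 (g - g') = g (g - g') + (g - g') g'] the element [g - g'] is an average of products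
   with ever longer small factors; hence the square root is unique and so hermitian. *)
Lemma quadratic_fixpoint_unique h g (g' : U) : small U g -> small U g' ->
  RtoC 2 *: g = h +' g *' g -> RtoC 2 *: g' = h +' g' *' g' -> g = g'.
Proof.
  intros (C & q & HC & Hq & Hg) (C' & q' & HC' & Hq' & Hg') E E'.
  set (d := g -' g').
  assert (Hd : d = RtoC (1 / 2) *: (g *' d +' d *' g')).
  { transitivity (RtoC (1 / 2) *: (RtoC 2 *: g -' RtoC 2 *: g')); [unfold d; alg |].
    rewrite E, E'; unfold d; alg. }
  assert (Hdef : g -' g' = d) by reflexivity; clearbody d.
  set (r := Rmax q q').
  assert (Hr : q <= r /\ q' <= r /\ r < 1).
  { repeat split; [apply Rmax_l | apply Rmax_r | apply Rmax_lub_lt; lra]. }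
  set (K := C * C' * bs_norm d).
  pose proof (bs_norm_nonneg _ d) as Hnd.
  assert (HK : 0 <= K) by (unfold K; repeat apply Rmult_le_pos; lra).
  assert (Hn : forall n i j, bs_norm (pw U g i *' d *' pw U g' j) <= K * r ^ (i + j + n)).
  { induction n; intros i j.
    - rewrite Nat.add_0_r; eapply Rle_trans; [apply norm_mul3 |].
      specialize (Hg i); specialize (Hg' j).
      assert (q ^ i <= r ^ i) by (apply pow_incr; lra).
      assert (q' ^ j <= r ^ j) by (apply pow_incr; lra).
      pose proof (pow_le q i ltac:(lra)); pose proof (pow_le q' j ltac:(lra)).
      replace (K * r ^ (i + j)) with ((C * r ^ i) * bs_norm d * (C' * r ^ j))
        by (unfold K; rewrite pow_add; ring).
      apply Rmult_le_compat; try apply bs_norm_nonneg.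
      + apply Rmult_le_pos; auto; apply bs_norm_nonneg.
      + apply Rmult_le_compat_r; auto; nra.
      + nra.
    - replace (pw U g i *' d *' pw U g' j) with
        (RtoC (1 / 2) *: (pw U g (S i) *' d *' pw U g' j +' pw U g i *' d *' pw U g' (S j))).
      + rewrite norm_scal_R by lra.
        pose proof (bs_norm_triangle _ (pw U g (S i) *' d *' pw U g' j)
                      (pw U g i *' d *' pw U g' (S j))).
        pose proof (IHn (S i) j) as H1; pose proof (IHn i (S j)) as H2.
        replace (S i + j + n)%nat with (i + j + S n)%nat in H1 by lia.
        replace (i + S j + n)%nat with (i + j + S n)%nat in H2 by lia.
        lra.
      + rewrite Hd at 3; rewrite pw_S_r; simpl; alg. }
  apply sub_eq_zero; rewrite Hdef.
  apply bs_norm_eq0, Rle_antisym; auto.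
  apply Rnot_lt_le; intro Hpos.
  destruct (pow_lt_1_zero r) with (y := bs_norm d / (K + 1)) as [N HN].
  - rewrite Rabs_pos_eq; lra.
  - apply Rdiv_lt_0_compat; lra.
  - specialize (HN N (le_n _)); rewrite Rabs_pos_eq in HN by (apply pow_le; lra).
    pose proof (Hn N O O) as H0; simpl in H0; rewrite mul_one_l, mul_one_r in H0.
    apply Rlt_div_r in HN; [| lra].
    pose proof (pow_le r N ltac:(lra)); nra.
Qed.

Lemma hermitian_sqrt h : h^* = h -> small U h ->
  exists b, b^* = b /\ b *' b = one -' h.
Proof.
  intros Hh Hs; destruct (quadratic_fixpoint h Hs) as (g & Hg & E).
  assert (Hgg : g^* = g).
  { apply (quadratic_fixpoint_unique h); auto; [apply small_star; auto |].
    rewrite <- star_RtoC, E; stars; rewrite Hh; auto. }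
  exists (one -' g); split.
  - rewrite star_sub, star_one, Hgg; auto.
  - transitivity (one -' RtoC 2 *: g +' g *' g); [alg | rewrite E; alg].
Qed.
End SquareRoot.

(** * Positivity in hermitian algebras *)

Section Hermitian.
Variable U : UnitalBanachStarAlgebra.
Hypothesis HU : forall h : U, h^* = h -> forall c, Cim c <> 0 -> invertible U (c *: one +' h).
Implicit Types x y z a b g h p : U.

(** Take b hermitian with b^2 = 1 - a^* a and y = b^-1. The product equals b^2 + (a^* - a) = b (1 +
    y (a^* - a) y) b. As a^* - a is skew, the middle factor is i (T - i) with T hermitian, hence
    invertible. *)
Lemma ptak_product a : small U (a^* *' a) -> invertible U ((one +' a^*) *' (one -' a)).
Proof.
  intro Hs.
  destruct (hermitian_sqrt U (a^* *' a)) as (b & Hb & Hbb); auto; [stars; auto |].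
  assert (Hi : invertible U b).
  { apply (invertible_commuting_factor U b b); auto.
    rewrite Hbb; apply small_invertible; auto. }
  pose proof Hi as [y Hy].
  pose proof (inverse_hermitian U _ _ Hb Hy) as Hyh.
  set (T := mkC 0 (-1) *: (y *' (a^* -' a) *' y)).
  assert (HT : T^* = T).
  { unfold T; stars; rewrite Hyh.
    replace (Cconj (mkC 0 (-1))) with (mkC 0 1) by creal; alg. }
  assert (E : (one +' a^*) *' (one -' a) =
              mkC 0 1 *: (b *' (mkC 0 (-1) *: one +' T) *' b)).
  { destruct Hy as [H1 H2].
    transitivity (b *' b +' (b *' y) *' (a^* -' a) *' (y *' b)).
    - rewrite H1, H2, Hbb; alg.
    - unfold T; alg. }
  rewrite E; apply invertible_scal.
  - intro H; apply (f_equal Cim) in H; simpl in H; lra.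
  - repeat apply invertible_mul; auto.
    apply HU; auto; simpl; lra.
Qed.

(** [ptak_product] yields a left inverse of 1 - a. The same lemma at the negative of the adjoint of
    [a] yields a right inverse, since a a^* is small together with a^* a. *)
Lemma ptak_invertible a : small U (a^* *' a) -> invertible U (one -' a).
Proof.
  intro Hs; apply invertible_factor with (one +' a^*) (one +' a^*).
  - apply ptak_product; auto.
  - pose proof (ptak_product (bs_opp a^*)) as H.
    rewrite star_opp, bs_star_star in H.
    replace ((one -' a) *' (one +' a^*)) with ((one +' bs_opp a) *' (one -' bs_opp a^*)) by alg.
    apply H.
    replace (bs_opp a *' bs_opp a^*) with (a *' a^*) by alg.
    apply small_swap; auto.
Qed.

(** Ptak's inequality r(a)^2 <= r(a^* a) at the level one: the hypothesis is stable under scalars of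
    modulus at most one, so [ptak_invertible] covers all c a in the resolvent criterion. *)
Lemma ptak a : small U (a^* *' a) -> small U a.
Proof.
  intro Hs; apply small_of_resolvent; intros c Hc; apply ptak_invertible.
  stars.
  replace (Cconj c *: a^* *' (c *: a)) with ((Cmul (Cconj c) c) *: (a^* *' a)) by alg.
  apply small_scal_le; auto.
  rewrite Cmod_mul, Cmod_conj; pose proof (Cmod_ge0 c); nra.
Qed.

(** Ptak's inequality reduces a b to b a a b, which is small together with a^2 b^2 by [small_swap].
    Iteration leads to a^(2^k) b^(2^k), of norm below one. *)
Lemma small_mul a b : a^* = a -> b^* = b -> small U a -> small U b -> small U (a *' b).
Proof.
  intros Ha Hb Hsa Hsb.
  destruct (small_sqi_eventually U a 1 Hsa) as [k1 H1]; [lra |].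
  destruct (small_sqi_eventually U b 1 Hsb) as [k2 H2]; [lra |].
  specialize (H1 (k1 + k2)%nat ltac:(lia)); specialize (H2 (k1 + k2)%nat ltac:(lia)).
  assert (Hk : small U (sqi U (k1 + k2) a *' sqi U (k1 + k2) b)).
  { apply small_norm; eapply Rle_lt_trans; [apply bs_norm_mul |].
    pose proof (bs_norm_nonneg _ (sqi U (k1 + k2) a)).
    pose proof (bs_norm_nonneg _ (sqi U (k1 + k2) b)); nra. }
  clear Hsa Hsb H1 H2; revert Hk; generalize (k1 + k2)%nat; intro k.
  revert a b Ha Hb; induction k; intros a b Ha Hb Hk; auto.
  apply ptak; stars; rewrite Ha, Hb.
  replace (b *' a *' (a *' b)) with (b *' (a *' a *' b)) by alg.
  apply small_swap.
  replace (a *' a *' b *' b) with (a *' a *' (b *' b)) by alg.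
  apply IHk; auto; stars; rewrite ?Ha, ?Hb; auto.
Qed.

(* The hermitian elements with nonnegative spectrum. *)
Definition pos h := h^* = h /\ forall s, 0 < s -> invertible U (RtoC s *: one +' h).

Lemma pos_scal t h : 0 <= t -> pos h -> pos (RtoC t *: h).
Proof.
  intros Ht [Hh Hp]; split; [rewrite star_RtoC, Hh; auto |].
  intros s Hs; destruct (Req_dec t 0) as [-> | Hnz].
  - exists (RtoC (/ s) *: one); split; alg.
  - apply invertible_scal_eq with (RtoC t) (RtoC (s / t) *: one +' h).
    + intro H; apply (f_equal Cre) in H; simpl in H; lra.
    + alg.
    + apply Hp, Rdiv_lt_0_compat; lra.
Qed.

Lemma pos_square k : k^* = k -> pos (k *' k).
Proof.
  intro Hk; split; [stars; rewrite Hk; auto |].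
  intros s Hs.
  assert (Hr : sqrt s * sqrt s = s) by (apply sqrt_sqrt; lra).
  assert (0 < sqrt s) by (apply sqrt_lt_R0; auto).
  replace (RtoC s *: one +' k *' k)
    with ((mkC 0 (sqrt s) *: one +' k) *' (mkC 0 (- sqrt s) *: one +' k)).
  - apply invertible_mul; apply HU; auto; simpl; lra.
  - transitivity (RtoC (sqrt s * sqrt s) *: one +' k *' k); [alg | rewrite Hr; auto].
Qed.

(** Since s + c h = c (s/c + h), it could only be singular with -s/c in the spectrum of [h], which
    forces [c] to be a negative real. *)
Lemma pos_pencil h s c : pos h -> 0 < s ->
  Cim c <> 0 \/ 0 <= Cre c -> invertible U (RtoC s *: one +' c *: h).
Proof.
  intros [Hh Hp] Hs Hc.
  destruct (classic (c = C0)) as [-> | Hc0].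
  - exists (RtoC (/ s) *: one); split; alg.
  - apply invertible_scal_eq with c (Cmul (RtoC s) (Cinv c) *: one +' h); auto.
    + transitivity (Cmul (RtoC s) (Cmul c (Cinv c)) *: one +' c *: h);
        [rewrite Cmul_inv; auto; alg | alg].
    + destruct (Req_dec (Cim c) 0) as [H0 | H0].
      * destruct Hc as [Hc | Hc]; [lra |].
        destruct c as [r i]; simpl in *; subst i.
        assert (0 < r) by (destruct Hc; auto; subst; exfalso; apply Hc0; reflexivity).
        replace (Cmul (RtoC s) (Cinv (mkC r 0))) with (RtoC (s / r)).
        -- apply Hp, Rdiv_lt_0_compat; lra.
        -- apply Cpx_ext; simpl; field; nra.
      * apply HU; auto.
        pose proof (Cinv_im c H0); change (s * Cim (Cinv c) + 0 * Cre (Cinv c) <> 0).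
        rewrite Rmult_0_l, Rplus_0_r; apply Rmult_integral_contrapositive_currified; lra.
Qed.

(** The function t/(1 + t) maps the half-line into [0, 1). Concretely 1 - c h y = (1 + (1 - c) h) y,
    and 1 - c has nonnegative real part for |c| <= 1. *)
Lemma pos_quotient h : pos h ->
  exists y, y^* = y /\ inverse_of U (one +' h) y /\ small U (h *' y) /\ (h *' y)^* = h *' y.
Proof.
  intros Hp; pose proof Hp as [Hh Hi].
  destruct (Hi 1) as [y Hy]; [lra |].
  replace (RtoC 1 *: one +' h) with (one +' h) in Hy by alg.
  assert (Hyh : y^* = y).
  { apply (inverse_hermitian U (one +' h)); auto; stars; rewrite star_one, Hh; auto. }
  assert (Hc : h *' y = y *' h).
  { symmetry; apply (inverse_commute U (one +' h)); auto; alg. }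
  exists y; repeat split; auto; try apply Hy.
  - apply small_of_resolvent; intros c Hcm.
    replace (one -' c *: (h *' y))
      with ((RtoC 1 *: one +' Cadd C1 (Copp c) *: h) *' y).
    + apply invertible_mul.
      * apply pos_pencil; auto; [lra |].
        destruct (Req_dec (Cim c) 0); [right | left]; simpl; [| lra].
        pose proof (Cmod_re c); pose proof (Rle_abs (Cre c)); lra.
      * exists (one +' h); split; apply Hy.
    + destruct Hy as [H1 H2].
      transitivity ((one +' h) *' y -' c *: (h *' y)); [alg | rewrite H1; auto].
  - stars; rewrite Hh, Hyh; auto.
Qed.

(** After scaling, 1 + h + k = (1 + h)(1 - p q)(1 + k) with p = h (1 + h)^-1 and q = k (1 + k)^-1.
    Both are hermitian and small by [pos_quotient], and [small_mul] makes p q small. *)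
Lemma pos_add h k : pos h -> pos k -> pos (h +' k).
Proof.
  intros Hh Hk; split.
  { destruct Hh as [Hh _], Hk as [Hk _]; stars; rewrite Hh, Hk; auto. }
  intros s Hs.
  assert (Hs' : 0 <= / s) by (left; apply Rinv_0_lt_compat; auto).
  apply invertible_scal_eq with (RtoC s) (one +' RtoC (/ s) *: h +' RtoC (/ s) *: k).
  - intro H; apply (f_equal Cre) in H; simpl in H; lra.
  - alg.
  - apply (pos_scal _ _ Hs') in Hh; apply (pos_scal _ _ Hs') in Hk.
    set (h' := RtoC (/ s) *: h) in *; set (k' := RtoC (/ s) *: k) in *; clearbody h' k'.
    destruct (pos_quotient h' Hh) as (y & Hy & Hyi & Hys & Hyh).
    destruct (pos_quotient k' Hk) as (w & Hw & Hwi & Hws & Hwh).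
    assert (Hc : w *' k' = k' *' w) by (apply (inverse_commute U (one +' k')); auto; alg).
    assert (Hc' : y *' h' = h' *' y) by (apply (inverse_commute U (one +' h')); auto; alg).
    destruct Hyi as [Hy1 Hy2], Hwi as [Hw1 Hw2].
    replace (one +' h' +' k')
      with ((one +' h') *' (one -' (h' *' y) *' (k' *' w)) *' (one +' k')).
    + apply invertible_mul; [apply invertible_mul |].
      * exists y; split; auto.
      * apply small_invertible, small_mul; auto.
      * exists w; split; auto.
    + rewrite <- Hc', <- Hc.
      transitivity ((one +' h') *' (one +' k') -'
        ((one +' h') *' y) *' h' *' ((w *' k') *' (one +' k'))); [alg |].
      rewrite Hy1, Hc.
      transitivity ((one +' h') *' (one +' k') -' h' *' k' *' (w *' (one +' k'))); [alg |].
      rewrite Hw2; alg.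
Qed.
End Hermitian.

(** * The Shirali-Ford theorem *)

Section ShiraliFord.
Variable U : UnitalBanachStarAlgebra.
Hypothesis HU : forall h : U, h^* = h -> forall c, Cim c <> 0 -> invertible U (c *: one +' h).
Implicit Types x y z a b g h p : U.

(* With [h = a^* a] and [b = 2 a (1 + h)^-1] one has [1 - b^* b >= 0], hence
   [1 + b b^* = 2 u^2 + 2 v^2 + (1 - b^* b) >= 0] for [b = u + i v], so that [c + b^* b] is
   invertible for [c > 1]; multiplied by [(1 + h)^2] it factors as a multiple of
   [(1 + s h)(s + h)], where [s + 1/s = 2 + 4/c]. *)
Lemma shirali_ford_step a :
  (forall s, 0 <= s <= 1 -> invertible U (one +' RtoC s *: (a^* *' a))) ->
  forall s, 0 <= s <= 4 -> invertible U (one +' RtoC s *: (a^* *' a)).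
Proof.
  intros H s Hs; destruct (Rle_lt_dec s 1) as [| Hs1]; [apply H; lra |].
  destruct (H 1) as [y Hy]; [lra |].
  set (h := a^* *' a) in *.
  assert (Hh : h^* = h) by (unfold h; stars; auto).
  replace (one +' RtoC 1 *: h) with (one +' h) in Hy by alg.
  assert (Hyh : y^* = y).
  { apply (inverse_hermitian U (one +' h)); auto; stars; rewrite star_one, Hh; auto. }
  assert (Hc : y *' h = h *' y) by (apply (inverse_commute U (one +' h)); auto; alg).
  destruct Hy as [Hy1 Hy2].
  set (b := RtoC 2 *: (a *' y)).
  assert (Hbs : b^* = RtoC 2 *: (y *' a^*)).
  { unfold b; rewrite star_RtoC; stars; rewrite Hyh; auto. }
  set (u := RtoC (1 / 2) *: (b +' b^*)).
  set (v := mkC 0 (-1 / 2) *: (b -' b^*)).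
  (* Here b^* b = 4 h (1 + h)^-2, so 1 - b^* b is the square of (1 - h)(1 + h)^-1; this fixes the
     factor 2 in [b]. *)
  set (k := (one -' h) *' y).
  assert (Hu : u^* = u) by (unfold u; rewrite star_RtoC; stars; alg).
  assert (Hv : v^* = v).
  { unfold v; stars; replace (Cconj (mkC 0 (-1 / 2))) with (mkC 0 (1 / 2)) by creal; alg. }
  assert (Hk : k^* = k).
  { unfold k; stars; rewrite star_one, Hh, Hyh.
    transitivity (y -' y *' h); [alg | rewrite Hc; alg]. }
  assert (Hkk : k *' k = one -' b^* *' b).
  { rewrite Hbs.
    assert (E1 : y = one -' h *' y) by (rewrite <- Hy1; alg).
    assert (E2 : k = one -' RtoC 2 *: (h *' y)).
    { unfold k; transitivity (y -' h *' y); [alg | rewrite E1 at 1; alg]. }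
    transitivity (one -' RtoC 4 *: (y *' h *' y)); [| unfold b, h; alg].
    rewrite Hc, E2.
    transitivity (one -' RtoC 4 *: (h *' y) +' RtoC 4 *: (h *' (y *' h) *' y)); [alg |].
    rewrite Hc.
    transitivity (one -' RtoC 4 *: (h *' (one -' h *' y) *' y)); [alg |].
    rewrite <- E1; auto. }
  assert (Hpos : pos U (one +' b *' b^*)).
  { replace (one +' b *' b^*) with (u *' u +' u *' u +' (v *' v +' v *' v) +' k *' k).
    - repeat apply pos_add; auto; apply pos_square; auto.
    - rewrite Hkk; unfold u, v; alg. }
  (* With c = 1 + t this solves s + 1/s = 2 + 4/c. It is positive for 1 < s < 3 + 2 sqrt 2, which
     leaves room for the bound 4. *)
  set (t := (6 * s - s * s - 1) / ((s - 1) * (s - 1))).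
  assert (Ht : 0 < t) by (apply Rdiv_lt_0_compat; nra).
  assert (Hts : t * ((s - 1) * (s - 1)) = 6 * s - s * s - 1) by (unfold t; field; nra).
  clearbody t.
  assert (Hi : invertible U (RtoC (1 + t) *: one +' b^* *' b)).
  { replace (RtoC (1 + t) *: one +' b^* *' b)
      with (RtoC (1 + t) *: one -' bs_opp b^* *' b) by alg.
    apply invertible_swap.
    - intro E; apply (f_equal Cre) in E; simpl in E; lra.
    - destruct Hpos as [_ Hpos]; specialize (Hpos t Ht).
      replace (RtoC (1 + t) *: one -' b *' bs_opp b^*)
        with (RtoC t *: one +' (one +' b *' b^*)) by alg; auto. }
  apply (invertible_commuting_factor U _ (RtoC s *: one +' h)); [alg |].
  apply invertible_scal_eq with (RtoC (s / (1 + t)))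
    ((one +' h) *' (RtoC (1 + t) *: one +' b^* *' b) *' (one +' h)).
  - intro E; apply (f_equal Cre) in E; simpl in E.
    assert (0 < s / (1 + t)) by (apply Rdiv_lt_0_compat; lra); lra.
  - rewrite Hbs.
    transitivity (RtoC (s / (1 + t)) *: (RtoC (1 + t) *: ((one +' h) *' (one +' h)) +'
      RtoC 4 *: (((one +' h) *' y) *' h *' (y *' (one +' h))))); [| unfold b, h; alg].
    rewrite Hy1, Hy2.
    replace (RtoC 4) with (RtoC ((1 + t) * (s + / s - 2))).
    + alg.
    + f_equal; apply Rmult_eq_reg_r with s; [| lra]. field_simplify; [nra | lra].
  - assert (invertible U (one +' h)) by (exists y; split; auto).
    repeat apply invertible_mul; auto.
Qed.

(** Neumann's series handles small s. Applied to sqrt(R0) a, the preceding step multiplies the range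
    of admissible s by four, so every s >= 0 is reached. *)
Theorem shirali_ford a : pos U (a^* *' a).
Proof.
  set (h := a^* *' a).
  assert (Hh : h^* = h) by (unfold h; stars; auto).
  pose proof (bs_norm_nonneg _ h) as Hn.
  set (r := / (bs_norm h + 1)).
  assert (Hr : 0 < r) by (apply Rinv_0_lt_compat; lra).
  assert (Hrh : r * (bs_norm h + 1) = 1) by (apply Rinv_l; lra).
  clearbody r.
  assert (Hall : forall n s, 0 <= s <= r * 4 ^ n -> invertible U (one +' RtoC s *: h)).
  { induction n; intros s Hs.
    - replace (one +' RtoC s *: h) with (one -' bs_opp (RtoC s *: h)) by alg.
      apply small_invertible, small_norm.
      rewrite norm_opp, norm_scal_R by lra; simpl in Hs; nra.
    - set (R0 := r * 4 ^ n) in *.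
      assert (HR0 : 0 < R0) by (apply Rmult_lt_0_compat; auto; apply pow_lt; lra).
      replace (r * 4 ^ S n) with (4 * R0) in Hs by (unfold R0; simpl; ring).
      clearbody R0.
      assert (E : forall t, RtoC t *: ((RtoC (sqrt R0) *: a)^* *' (RtoC (sqrt R0) *: a)) =
                            RtoC (t * R0) *: h).
      { intro t; rewrite <- (sqrt_sqrt R0) at 3 by lra.
        rewrite star_RtoC; unfold h; alg. }
      replace s with (s / R0 * R0) by (field; lra).
      rewrite <- E; apply shirali_ford_step.
      + intros t Ht; rewrite E; apply IHn; nra.
      + split; [apply Rdiv_le_0_compat; lra | apply Rle_div_l; lra]. }
  split; auto.
  intros s Hs.
  apply invertible_scal_eq with (RtoC s) (one +' RtoC (/ s) *: h).
  - intro E; apply (f_equal Cre) in E; simpl in E; lra.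
  - alg.
  - destruct (Pow_x_infinity 4 ltac:(rewrite Rabs_pos_eq; lra) (/ (s * r))) as [n Hpw].
    specialize (Hpw n (le_n _)); rewrite Rabs_pos_eq in Hpw by (apply pow_le; lra).
    apply (Hall n).
    split; [left; apply Rinv_0_lt_compat; auto |].
    replace (/ s) with (r * / (s * r)) by (field; lra).
    apply Rmult_le_compat_l; lra.
Qed.
End ShiraliFord.

(** * States on a *-subalgebra *)

(** Abstract because Cauchy-Schwarz is applied to phi (y^* x), to its covariance, and later to the
    extended functional. Hermitian symmetry is derived by polarization in [form_hermitian]. *)
Record psd_form (A : BanachStarAlgebra) (D : A -> Prop) (B : A -> A -> Cpx) : Prop := {
  form_add_l : forall x y z, D x -> D y -> D z -> B (x +' y) z = Cadd (B x z) (B y z);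
  form_add_r : forall x y z, D x -> D y -> D z -> B x (y +' z) = Cadd (B x y) (B x z);
  form_scal_l : forall c x y, D x -> D y -> B (c *: x) y = Cmul c (B x y);
  form_scal_r : forall c x y, D x -> D y -> B x (c *: y) = Cmul (Cconj c) (B x y);
  form_pos : forall x, D x -> Cim (B x x) = 0 /\ 0 <= Cre (B x x)
}.

Section Form.
Variables (A : BanachStarAlgebra) (D : A -> Prop) (B : A -> A -> Cpx).
Hypothesis HB : psd_form A D B.
Hypothesis Dadd : forall x y, D x -> D y -> D (x +' y).
Hypothesis Dscal : forall c x, D x -> D (c *: x).

Lemma form_expand c x y : D x -> D y ->
  B (x +' c *: y) (x +' c *: y) =
  Cadd (Cadd (B x x) (Cmul (Cconj c) (B x y)))
       (Cadd (Cmul c (B y x)) (Cmul (Cmul c (Cconj c)) (B y y))).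
Proof.
  intros Hx Hy; destruct HB as [al ar sl sr _].
  rewrite al, !ar, !sl, !sr, ?sl by auto.
  f_equal; f_equal; creal.
Qed.

Lemma form_hermitian x y : D x -> D y -> B y x = Cconj (B x y).
Proof.
  intros Hx Hy.
  pose proof (form_expand C1 x y Hx Hy) as E1.
  pose proof (form_expand (mkC 0 1) x y Hx Hy) as E2.
  destruct (form_pos _ _ _ HB (x +' C1 *: y)) as [H1 _]; auto.
  destruct (form_pos _ _ _ HB (x +' mkC 0 1 *: y)) as [H2 _]; auto.
  destruct (form_pos _ _ _ HB x Hx) as [H3 _].
  destruct (form_pos _ _ _ HB y Hy) as [H4 _].
  rewrite E1 in H1; rewrite E2 in H2; simpl in H1, H2.
  apply Cpx_ext; simpl; lra.
Qed.

Lemma form_cauchy_schwarz x y : D x -> D y ->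
  Cmod (B x y) ^ 2 <= Cre (B x x) * Cre (B y y).
Proof.
  intros Hx Hy.
  destruct (form_pos _ _ _ HB x Hx) as [_ Hxx].
  destruct (form_pos _ _ _ HB y Hy) as [Hyi Hyy].
  pose proof (form_hermitian x y Hx Hy) as Hyx.
  set (b := Cmod (B x y) ^ 2).
  assert (Hb : 0 <= b) by apply pow2_ge_0.
  assert (H : forall l, 0 <= Cre (B x x) - 2 * l * b + l * l * b * Cre (B y y)).
  { intro l.
    destruct (form_pos _ _ _ HB (x +' Cmul (RtoC (- l)) (B x y) *: y)) as [_ H]; auto.
    rewrite form_expand, Hyx in H by auto; simpl in H; rewrite Hyi in H.
    unfold b; rewrite Cmod_sqr; nra. }
  clearbody b.
  destruct Hyy as [Hpos | H0].
  - specialize (H (/ Cre (B y y))).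
    apply Rmult_le_compat_l with (r := Cre (B y y)) in H; [| lra].
    replace (Cre (B y y) * (Cre (B x x) - 2 * / Cre (B y y) * b +
      / Cre (B y y) * / Cre (B y y) * b * Cre (B y y)))
      with (Cre (B x x) * Cre (B y y) - b) in H by (field; lra).
    lra.
  - rewrite <- H0 in *; apply Rnot_lt_le; intro Hlt.
    assert (Hb' : 0 < b) by lra.
    (* With B y y = 0 the bound is affine in l; this l makes it equal to -1. *)
    specialize (H ((Cre (B x x) + 1) / (2 * b))).
    replace (2 * ((Cre (B x x) + 1) / (2 * b)) * b) with (Cre (B x x) + 1) in H by (field; lra).
    lra.
Qed.
End Form.

(** * States on D and their values on C1 + D *)

Section State.
Variable U : UnitalBanachStarAlgebra.
Hypothesis HU : forall h : U, h^* = h -> forall c, Cim c <> 0 -> invertible U (c *: one +' h).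
Variable D : U -> Prop.
Hypothesis Dadd : forall x y, D x -> D y -> D (x +' y).
Hypothesis Dscal : forall c x, D x -> D (c *: x).
Hypothesis Dmul : forall x y, D x -> D y -> D (x *' y).
Hypothesis Dstar : forall x, D x -> D x^*.
(** The norm controls the scalar part of elements of C1 + D; in particular the unit is not in [D],
    so that phi 1 = 1 may be prescribed. [norm_affine_embed] provides this in the unitization. *)
Hypothesis Dsep : forall m d, D d -> Rabs m <= bs_norm (RtoC m *: one +' d).
Variable phi : U -> Cpx.
Hypothesis phi_state : is_state U D phi.
Implicit Types x y z a b d h : U.

Lemma phi_add x y : D x -> D y -> phi (x +' y) = Cadd (phi x) (phi y).
Proof. destruct phi_state as ((H & _) & _); apply H. Qed.

Lemma phi_scal c x : D x -> phi (c *: x) = Cmul c (phi x).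
Proof. destruct phi_state as ((_ & H) & _); apply H. Qed.

Let nn x := Cre (phi (x^* *' x)).

Lemma state_form : psd_form U D (fun x y => phi (y^* *' x)).
Proof.
  split; intros.
  - rewrite bs_mul_addr, phi_add; auto.
  - rewrite bs_star_add, bs_mul_addl, phi_add; auto.
  - rewrite bs_mul_scalr, phi_scal; auto.
  - rewrite bs_star_scal, bs_mul_scall, phi_scal; auto.
  - destruct phi_state as (_ & H0 & _); apply H0; auto.
Qed.

(** The covariance of x and y under phi; its positivity is the bound one on the variation. *)
Lemma state_variance_form :
  psd_form U D (fun x y => Cadd (phi (y^* *' x)) (Copp (Cmul (phi x) (Cconj (phi y))))).
Proof.
  destruct state_form as [al ar sl sr p].
  split; intros.
  - rewrite al, phi_add by auto; creal.
  - rewrite ar, phi_add by auto; creal.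
  - rewrite sl, phi_scal by auto; creal.
  - rewrite sr, phi_scal by auto; creal.
  - destruct (p x H) as [H1 _].
    destruct phi_state as (_ & _ & _ & ((_ & Hv) & _)).
    specialize (Hv x H); rewrite Cmod_sqr in Hv; simpl; lra.
Qed.

Lemma state_cauchy_schwarz x y : D x -> D y -> Cmod (phi (y^* *' x)) ^ 2 <= nn x * nn y.
Proof. apply (form_cauchy_schwarz U D _ state_form); auto. Qed.

(** Cauchy-Schwarz for the covariance. If |phi c|^2 nearly equals phi (c^* c), then phi (c^* x) is
    nearly phi x times the conjugate of phi c. *)
Lemma state_covariance x c : D x -> D c ->
  Cmod (Cadd (phi (c^* *' x)) (Copp (Cmul (phi x) (Cconj (phi c))))) ^ 2 <=
  nn x * (nn c - Cmod (phi c) ^ 2).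
Proof.
  intros Hx Hc.
  pose proof (form_cauchy_schwarz U D _ state_variance_form Dadd Dscal x c Hx Hc) as H.
  simpl Cre in H.
  assert (0 <= nn x) by (apply (form_pos _ _ _ state_form x Hx)).
  destruct (form_pos _ _ _ state_variance_form c Hc) as [_ Hc2].
  simpl in Hc2.
  rewrite (Cmod_sqr (phi c)).
  eapply Rle_trans; [exact H |]; unfold nn in *.
  destruct (form_pos _ _ _ state_variance_form x Hx) as [_ Hx2]; simpl in Hx2.
  apply Rmult_le_compat; try lra.
  pose proof (Rle_0_sqr (Cre (phi x))); pose proof (Rle_0_sqr (Cim (phi x))).
  unfold Rsqr in *; lra.
Qed.

Lemma state_star x y : D x -> D y -> phi (x^* *' y) = Cconj (phi (y^* *' x)).
Proof. apply (form_hermitian U D _ state_form); auto. Qed.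

Lemma nn_nonneg x : D x -> 0 <= nn x.
Proof. apply (form_pos _ _ _ state_form). Qed.

(** Continuity at zero and homogeneity. The constant depends on [c], without harm: the iteration in
    [state_small_bound] eliminates it. *)
Lemma state_weak_bound c : D c -> exists K, 0 <= K /\
  forall b, D b -> b^* = b -> Cmod (phi (c^* *' (b *' c))) <= K * bs_norm b.
Proof.
  intro Hc.
  assert (D0 : D bs_zero) by (rewrite <- (scal_zero_l _ c); auto).
  destruct phi_state as (_ & _ & Hw & _).
  destruct (Hw c Hc bs_zero D0 (star_zero U) 1) as (e & He & H); [lra |].
  exists (2 / e); split; [left; apply Rdiv_lt_0_compat; lra |].
  intros b Hb Hbs.
  assert (E0 : phi (c^* *' (bs_zero *' c)) = C0).
  { replace (c^* *' (bs_zero *' c)) with (C0 *: c) by alg.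
    rewrite phi_scal by auto; creal. }
  rewrite E0 in H.
  destruct (bs_norm_nonneg _ b) as [Hpos | Hz].
  - set (t := e / (2 * bs_norm b)).
    assert (Ht : 0 < t) by (apply Rdiv_lt_0_compat; lra).
    assert (Htb : t * bs_norm b = e / 2) by (unfold t; field; lra).
    specialize (H (RtoC t *: b)).
    replace (c^* *' (RtoC t *: b *' c)) with (RtoC t *: (c^* *' (b *' c))) in H by alg.
    rewrite phi_scal in H by auto.
    replace (Cadd (Cmul (RtoC t) (phi (c^* *' (b *' c)))) (Copp C0))
      with (Cmul (RtoC t) (phi (c^* *' (b *' c)))) in H by creal.
    rewrite Cmod_mul, Cmod_pos_RtoC in H by lra.
    assert (Hlt : t * Cmod (phi (c^* *' (b *' c))) < 1).
    { apply H; auto.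
      - unfold hermitian_elt; rewrite star_RtoC, Hbs; auto.
      - replace (RtoC t *: b -' bs_zero) with (RtoC t *: b) by alg.
        rewrite norm_scal_R; lra. }
    apply Rmult_le_reg_l with t; auto.
    replace (t * (2 / e * bs_norm b)) with (2 / e * (t * bs_norm b)) by ring.
    rewrite Htb; replace (2 / e * (e / 2)) with 1 by (field; lra); lra.
  - symmetry in Hz; rewrite Hz; apply bs_norm_eq0 in Hz; subst b.
    rewrite E0, Rmult_0_r; right; apply Cmod_unique; simpl; lra.
Qed.

Lemma affine_sqi m d k : D d -> d^* = d ->
  exists m' d', D d' /\ d'^* = d' /\ sqi U k (RtoC m *: one +' d) = RtoC m' *: one +' d'.
Proof.
  revert m d; induction k; intros m d Hd Hds; [exists m, d; auto |].
  simpl.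
  replace ((RtoC m *: one +' d) *' (RtoC m *: one +' d))
    with (RtoC (m * m) *: one +' (RtoC (2 * m) *: d +' d *' d)) by alg.
  apply IHk; auto.
  rewrite bs_star_add, star_RtoC; stars; rewrite Hds; auto.
Qed.

Lemma affine_mul m d c : D d -> D c -> D ((RtoC m *: one +' d) *' c).
Proof.
  intros; replace ((RtoC m *: one +' d) *' c) with (RtoC m *: c +' d *' c) by alg; auto.
Qed.

(** Let f k be the modulus at the power X^(2^k). Cauchy-Schwarz gives f(k)^2 <= nn c f(k+1), so f 0
    > nn c would keep every f k above f 0, whereas the weak bound sends f k to 0 with the powers of
    X. *)
Lemma state_small_bound m d c : D d -> d^* = d -> D c -> small U (RtoC m *: one +' d) ->
  Cmod (phi (c^* *' ((RtoC m *: one +' d) *' c))) <= nn c.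
Proof.
  intros Hd Hds Hc Hs.
  set (X := RtoC m *: one +' d) in *.
  pose (f k := Cmod (phi (c^* *' (sqi U k X *' c)))).
  assert (Hn : 0 <= nn c) by (apply nn_nonneg; auto).
  assert (Hf : forall k, f k ^ 2 <= nn c * f (S k)).
  { intro k; destruct (affine_sqi m d k Hd Hds) as (m' & d' & Hd' & Hds' & E).
    assert (HX : D (sqi U k X *' c)) by (unfold X; rewrite E; apply affine_mul; auto).
    unfold f; eapply Rle_trans; [apply state_cauchy_schwarz; auto |].
    rewrite Rmult_comm; apply Rmult_le_compat_l; auto.
    unfold nn; rewrite sqi_S.
    replace ((sqi U k X *' c)^* *' (sqi U k X *' c))
      with (c^* *' (sqi U k X *' sqi U k X *' c)).
    - eapply Rle_trans; [apply Rle_abs | apply Cmod_re].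
    - assert (Hst : (sqi U k X)^* = sqi U k X)
        by (unfold X; rewrite E, bs_star_add, star_RtoC, star_one, Hds'; auto).
      rewrite bs_star_mul, Hst; alg. }
  destruct (state_weak_bound c Hc) as (K & HK & Hb).
  (* By [Dsep] the scalar part is at most the norm of the power, and the part in [D] at most twice
     that norm; hence the factor 2 K. *)
  assert (Hlim : forall k, f k <= (nn c + 2 * K) * bs_norm (sqi U k X)).
  { intro k; destruct (affine_sqi m d k Hd Hds) as (m' & d' & Hd' & Hds' & E).
    unfold f, X; rewrite E.
    replace (c^* *' ((RtoC m' *: one +' d') *' c))
      with (RtoC m' *: (c^* *' c) +' c^* *' (d' *' c)) by alg.
    rewrite phi_add, phi_scal by auto.
    eapply Rle_trans; [apply Cmod_triangle |].
    rewrite Cmod_mul, Cmod_RtoC.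
    pose proof (Dsep m' d' Hd') as Hm; specialize (Hb d' Hd' Hds').
    assert (Hcc : Cmod (phi (c^* *' c)) = nn c).
    { destruct (form_pos _ _ _ state_form c Hc) as [Hi _].
      apply Cmod_unique; auto; unfold nn; rewrite Hi; ring. }
    rewrite Hcc.
    assert (Hd2 : bs_norm d' <= bs_norm (RtoC m' *: one +' d') + Rabs m').
    { replace d' with (RtoC m' *: one +' d' -' RtoC m' *: one) at 1 by alg.
      rewrite <- Cmod_RtoC, <- (norm_scal_one U (RtoC m')); apply norm_sub_le. }
    pose proof (Rabs_pos m'); pose proof (bs_norm_nonneg _ d'); nra. }
  apply Rnot_lt_le; intro Hlt.
  change (nn c < f O) in Hlt.
  assert (Hgrow : forall k, f O <= f k).
  { induction k; [lra |]; specialize (Hf k).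
    apply Rnot_lt_le; intro Hlt2; nra. }
  assert (Hp : 0 < f O) by lra.
  destruct (small_sqi_eventually U X (f O / (nn c + 2 * K + 1)) Hs) as [k Hk].
  { apply Rdiv_lt_0_compat; lra. }
  specialize (Hk k (le_n _)); specialize (Hlim k); specialize (Hgrow k).
  apply Rlt_div_r in Hk; [| lra].
  pose proof (bs_norm_nonneg _ (sqi U k X)); nra.
Qed.

(* Near-maximizers [c] of [|phi c|^2 / phi (c^* c)] act as an approximate cyclic vector. *)
Lemma state_near_maximizer e : 0 < e < 1 -> exists c, D c /\ nn c = 1 /\
  1 - e <= Cmod (phi c) ^ 2 <= 1.
Proof.
  intro He; destruct phi_state as (_ & _ & _ & ((_ & Hle) & Hmin)).
  assert (Hex : exists b, D b /\ (1 - e) * nn b < Cmod (phi b) ^ 2).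
  { apply NNPP; intro Hno.
    assert (1 <= 1 - e); [| lra].
    apply Hmin; split; [lra |]; intros b Hb.
    apply Rnot_lt_le; intro Hlt; apply Hno; exists b; auto. }
  destruct Hex as (b & Hb & Hlt).
  pose proof (Hle b Hb) as H1; fold (nn b) in H1.
  assert (Hpos : 0 < nn b) by (pose proof (nn_nonneg b Hb); nra).
  set (s := / sqrt (nn b)).
  assert (Hq : 0 < sqrt (nn b)) by (apply sqrt_lt_R0; auto).
  assert (Hs : 0 < s) by (apply Rinv_0_lt_compat; auto).
  assert (Hss : s * s * nn b = 1).
  { rewrite <- (sqrt_sqrt (nn b)) by lra; unfold s; field; lra. }
  assert (Hnc : nn (RtoC s *: b) = 1).
  { unfold nn; rewrite star_RtoC.
    replace (RtoC s *: b^* *' (RtoC s *: b)) with (RtoC (s * s) *: (b^* *' b)) by alg.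
    rewrite phi_scal by auto; simpl; fold (nn b); lra. }
  assert (Hpc : Cmod (phi (RtoC s *: b)) ^ 2 = s * s * Cmod (phi b) ^ 2).
  { rewrite phi_scal, Cmod_mul, Cmod_pos_RtoC by (auto; lra); ring. }
  exists (RtoC s *: b); split; [auto | split; [auto |]].
  rewrite Hpc; assert (0 < s * s) by nra; nra.
Qed.

(** [state_covariance] for h and for h c removes the two factors c from phi (c^* h c) and leaves
    |phi c|^2 phi h up to a conjugation, which disappears because phi (c^* h c) is real. *)
Lemma state_approx h e : D h -> h^* = h -> 0 < e -> exists c, D c /\ nn c = 1 /\
  Cmod (Cadd (phi h) (Copp (phi (c^* *' (h *' c))))) <= e.
Proof.
  intros Hh Hhs He.
  set (N := bs_norm (h *' h) + 1).
  assert (HN : 0 < N) by (pose proof (bs_norm_nonneg _ (h *' h)); unfold N; lra).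
  (* The bound must be uniform in [c], which is chosen after [N]; [state_small_bound] at h h / N
     provides this. *)
  assert (Hhh : forall c, D c -> nn c = 1 -> nn (h *' c) <= N).
  { intros c Hc Hc1.
    pose proof (state_small_bound 0 (RtoC (/ N) *: (h *' h)) c) as Hb.
    rewrite Hc1 in Hb.
    replace (c^* *' ((RtoC 0 *: one +' RtoC (/ N) *: (h *' h)) *' c))
      with (RtoC (/ N) *: ((h *' c)^* *' (h *' c))) in Hb by (stars; rewrite Hhs; alg).
    rewrite phi_scal, Cmod_mul, Cmod_pos_RtoC in Hb;
      [| left; apply Rinv_0_lt_compat; auto | auto].
    assert (Hb1 : / N * Cmod (phi ((h *' c)^* *' (h *' c))) <= 1).
    { apply Hb; auto.
      - rewrite star_RtoC; stars; rewrite Hhs; auto.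
      - replace (RtoC 0 *: one +' RtoC (/ N) *: (h *' h)) with (RtoC (/ N) *: (h *' h)) by alg.
        apply small_norm; rewrite norm_scal_R by (left; apply Rinv_0_lt_compat; auto).
        apply Rmult_lt_reg_l with N; auto; rewrite <- Rmult_assoc, Rinv_r by lra.
        unfold N; lra. }
    apply Rmult_le_compat_l with (r := N) in Hb1; [| lra].
    rewrite <- Rmult_assoc, Rinv_r in Hb1 by lra.
    unfold nn; pose proof (Cmod_re (phi ((h *' c)^* *' (h *' c)))).
    pose proof (Rle_abs (Cre (phi ((h *' c)^* *' (h *' c))))); lra. }
  pose proof (nn_nonneg h Hh) as Hnh; pose proof (Cmod_ge0 (phi h)) as Hph.
  set (S := Cmod (phi h) + (N + 1) + (nn h + 1)).
  assert (HS : 0 < S) by (unfold S; lra).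
  set (r := Rmin (1 / 2) (e / S)).
  assert (Hr : 0 < r <= 1 / 2).
  { split; [apply Rmin_glb_lt; [lra | apply Rdiv_lt_0_compat; auto] | apply Rmin_l]. }
  assert (HrS : r * S <= e) by (apply Rle_div_r; auto; apply Rmin_r).
  clearbody r.
  (* The covariance bounds concern squares, so a defect r^2 gives errors linear in r; [S] adds up
     the three constants. *)
  destruct (state_near_maximizer (r * r)) as (c & Hc & Hc1 & Hk); [nra |].
  exists c; split; [auto | split; [auto |]].
  set (k := phi c) in *.
  pose proof (state_covariance h c Hh Hc) as H1.
  pose proof (state_covariance (h *' c) c (Dmul _ _ Hh Hc) Hc) as H2.
  fold k in H1, H2; rewrite Hc1 in H1, H2.
  set (e1 := Cadd (phi (c^* *' h)) (Copp (Cmul (phi h) (Cconj k)))) in *.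
  set (e2 := Cadd (phi (c^* *' (h *' c))) (Copp (Cmul (phi (h *' c)) (Cconj k)))) in *.
  assert (E1 : phi (h *' c) = Cconj (phi (c^* *' h))).
  { rewrite <- Hhs at 1; apply state_star; auto. }
  assert (E2 : phi (c^* *' (h *' c)) = Cconj (phi (c^* *' (h *' c)))).
  { transitivity (Cconj (phi ((h *' c)^* *' c))); [apply state_star; auto |].
    stars; rewrite Hhs; do 2 f_equal; alg. }
  assert (E : Cadd (phi h) (Copp (phi (c^* *' (h *' c)))) =
    Cadd (Cmul (RtoC (1 - Cmod k ^ 2)) (phi h))
         (Copp (Cadd (Cconj e2) (Cmul k e1)))).
  { rewrite E2; unfold e2; rewrite E1; unfold e1; rewrite Cmod_sqr; creal. }
  rewrite E.
  eapply Rle_trans; [apply Cmod_triangle |].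
  rewrite Cmod_opp, Cmod_mul, Cmod_pos_RtoC by lra.
  pose proof (Cmod_triangle (Cconj e2) (Cmul k e1)) as Ht.
  rewrite Cmod_conj, Cmod_mul in Ht.
  specialize (Hhh c Hc Hc1).
  pose proof (nn_nonneg (h *' c) (Dmul _ _ Hh Hc)).
  assert (Hsq : forall q u M, 0 <= u <= M -> q ^ 2 <= u * (1 - Cmod k ^ 2) -> q <= r * (M + 1)).
  { intros q u M Hu Hq; apply Rle_of_sqr_le; [apply Rmult_le_pos; lra |].
    apply Rle_trans with (M * (r * r)).
    - eapply Rle_trans; [exact Hq | apply Rmult_le_compat; lra].
    - assert (0 <= r * r * (M * M + M + 1)) by (repeat apply Rmult_le_pos; nra); nra. }
  assert (He2 : Cmod e2 <= r * (N + 1)) by (apply (Hsq _ (nn (h *' c))); auto).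
  assert (He1 : Cmod e1 <= r * (nn h + 1)) by (apply (Hsq _ (nn h)); auto; lra).
  pose proof (Cmod_ge0 k); pose proof (Cmod_ge0 e1).
  assert (Cmod k <= 1) by (apply Rle_of_sqr_le; lra).
  assert ((1 - Cmod k ^ 2) * Cmod (phi h) <= r * Cmod (phi h))
    by (apply Rmult_le_compat_r; nra).
  assert (Cmod k * Cmod e1 <= 1 * Cmod e1) by (apply Rmult_le_compat_r; auto).
  unfold S in HrS; lra.
Qed.

(** Not immediate, since [D] may lack a unit. The numbers phi (c^* h c) are real by the symmetry of
    the form, and they approximate phi h. *)
Lemma state_real h : D h -> h^* = h -> Cim (phi h) = 0.
Proof.
  intros Hh Hhs.
  assert (H : forall e, 0 < e -> Rabs (Cim (phi h)) <= e).
  { intros e He; destruct (state_approx h e Hh Hhs He) as (c & Hc & _ & Hce).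
    eapply Rle_trans; [| exact Hce].
    eapply Rle_trans; [| apply Cmod_im]; right; f_equal; simpl.
    assert (E2 : phi (c^* *' (h *' c)) = Cconj (phi (c^* *' (h *' c)))).
    { transitivity (Cconj (phi ((h *' c)^* *' c))); [apply state_star; auto |].
    stars; rewrite Hhs; do 2 f_equal; alg. }
    apply (f_equal Cim) in E2; simpl in E2; lra. }
  destruct (Req_dec (Cim (phi h)) 0) as [| Hne]; auto.
  apply Rabs_pos_lt in Hne; specialize (H (Rabs (Cim (phi h)) / 2)); lra.
Qed.

Lemma state_affine_small m d : D d -> d^* = d -> small U (RtoC m *: one +' d) ->
  m + Cre (phi d) <= 1.
Proof.
  intros Hd Hds Hs; apply le_epsilon; intros e He.
  destruct (state_approx d e Hd Hds He) as (c & Hc & Hc1 & Hce).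
  pose proof (state_small_bound m d c Hd Hds Hc Hs) as Hb; rewrite Hc1 in Hb.
  replace (c^* *' ((RtoC m *: one +' d) *' c))
    with (RtoC m *: (c^* *' c) +' c^* *' (d *' c)) in Hb by alg.
  rewrite phi_add, phi_scal in Hb by auto.
  pose proof (Cmod_re (Cadd (Cmul (RtoC m) (phi (c^* *' c))) (phi (c^* *' (d *' c))))) as H1.
  pose proof (Cmod_re (Cadd (phi d) (Copp (phi (c^* *' (d *' c)))))) as H2.
  simpl in H1, H2; fold (nn c) in H1; rewrite Hc1 in H1.
  pose proof (Rle_abs (m * 1 - 0 * Cim (phi (c^* *' c)) + Cre (phi (c^* *' (d *' c))))).
  pose proof (Rle_abs (Cre (phi d) + - Cre (phi (c^* *' (d *' c))))).
  lra.
Qed.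

(** For z nonzero in the unit disc, 1 - z (t - x)/(t + s) is a multiple of w + x with w = (t + s)/z
    - t. This is invertible by positivity if z > 0, where w >= s; by Neumann's series if z < 0,
    where |w| exceeds the norm of x; and by hermiticity if z is not real. *)
Lemma pos_small_complement x t s : pos U x -> bs_norm x < t -> 0 < s ->
  small U (RtoC (/ (t + s)) *: (RtoC t *: one -' x)).
Proof.
  intros Hx Ht Hs; pose proof (bs_norm_nonneg _ x) as Hn.
  apply small_of_resolvent; intros z Hz.
  destruct (classic (z = C0)) as [-> | Hz0].
  { exists one; split; alg. }
  set (w := Cadd (Cmul (RtoC (t + s)) (Cinv z)) (RtoC (- t))).
  assert (Hw : invertible U (w *: one +' x)).
  { destruct (Req_dec (Cim z) 0) as [H0 | H0].
    - destruct z as [u v]; simpl in H0; subst v.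
      assert (Hu : u <> 0) by (intros ->; apply Hz0; reflexivity).
      assert (Hu1 : Rabs u <= 1).
      { eapply Rle_trans; [| exact Hz]; apply (Cmod_re (mkC u 0)). }
      apply Rabs_le_between in Hu1.
      assert (Ew : w = RtoC ((t + s) / u - t)).
      { apply Cpx_ext; simpl; field; nra. }
      rewrite Ew; set (q := (t + s) / u) in *.
      assert (Hq : q * u = t + s) by (unfold q; field; auto); clearbody q.
      destruct (Rlt_le_dec 0 u) as [Hup | Hun].
      + apply Hx; nra.
      + assert (Hqt : q - t <= - t) by nra.
        apply invertible_scal_eq with (RtoC (q - t))
          (one -' bs_opp (RtoC (/ (q - t)) *: x)).
        * intro E; apply (f_equal Cre) in E; simpl in E; lra.
        * alg.
        * apply small_invertible, small_norm.
          rewrite norm_opp, bs_norm_scal, Cmod_RtoC, Rabs_inv, Rabs_left by lra.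
          apply Rmult_lt_reg_l with (- (q - t)); [lra |].
          rewrite <- Rmult_assoc, Rinv_r by lra; lra.
    - apply HU; [apply Hx |]; unfold w.
      pose proof (Cinv_im z H0) as Hi.
      change ((t + s) * Cim (Cinv z) + 0 * Cre (Cinv z) + 0 <> 0).
      rewrite Rmult_0_l, !Rplus_0_r; apply Rmult_integral_contrapositive_currified; lra. }
  apply invertible_scal_eq with (Cmul (RtoC (/ (t + s))) z) (w *: one +' x); auto.
  - intro E.
    assert (E' : Cmul (RtoC (t + s)) (Cmul (RtoC (/ (t + s))) z) = z) by creal.
    rewrite E in E'; apply Hz0; rewrite <- E'; creal.
  - unfold w.
    transitivity (RtoC (/ (t + s)) *:
      (Cmul (RtoC (t + s)) (Cmul z (Cinv z)) *: one -' RtoC t *: (z *: one) +' z *: x)).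
    + rewrite Cmul_inv by auto; alg.
    + alg.
Qed.

Lemma state_affine_pos m d : D d -> pos U (RtoC m *: one +' d) -> 0 <= m + Cre (phi d).
Proof.
  intros Hd Hp.
  assert (Hds : d^* = d).
  { destruct Hp as [Hh _]; rewrite bs_star_add, star_RtoC, star_one in Hh.
    apply add_cancel_l in Hh; auto. }
  set (t := bs_norm (RtoC m *: one +' d) + 1).
  assert (Ht : 0 < t) by (pose proof (bs_norm_nonneg _ (RtoC m *: one +' d)); unfold t; lra).
  apply Rnot_lt_le; intro Hlt.
  (* [state_affine_small] at (t - x)/(t + s), x = m + d, gives t - (m + phi d) <= t + s, which for
     this s reads 2 s <= s. *)
  set (s := - (m + Cre (phi d)) / 2).
  assert (Hs : 0 < s) by (unfold s; lra).
  assert (Hsm : small U (RtoC (/ (t + s)) *: (RtoC t *: one -' (RtoC m *: one +' d)))).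
  { apply pos_small_complement; auto; unfold t; lra. }
  replace (RtoC (/ (t + s)) *: (RtoC t *: one -' (RtoC m *: one +' d)))
    with (RtoC (/ (t + s) * (t - m)) *: one +' RtoC (- / (t + s)) *: d) in Hsm by alg.
  apply state_affine_small in Hsm; auto; [| rewrite star_RtoC, Hds; auto].
  rewrite phi_scal in Hsm by auto; simpl in Hsm.
  apply Rmult_le_compat_l with (r := t + s) in Hsm; [| lra].
  replace ((t + s) * (/ (t + s) * (t - m) + (- / (t + s) * Cre (phi d) - 0 * Cim (phi d))))
    with (t - m - Cre (phi d)) in Hsm by (field; lra).
  unfold s in Hsm; lra.
Qed.
End State.

(** * Extension of positive functionals *)

Section RieszExtension.
Variables (A : BanachStarAlgebra) (P : A -> Prop).
Hypothesis Padd : forall x y, P x -> P y -> P (x +' y).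
Hypothesis Pscal : forall t x, 0 <= t -> P x -> P (RtoC t *: x).

(* Partial functionals are represented by their graphs: a [P]-positive linear relation is
   automatically single-valued when [P] contains zero. *)
Definition positive_graph (G : A -> R -> Prop) :=
  (forall x r y s, G x r -> G y s -> G (x +' y) (r + s)) /\
  (forall t x r, G x r -> G (RtoC t *: x) (t * r)) /\
  (forall x r, G x r -> P x -> 0 <= r).

(** The value at [x] is the supremum of the values at elements below [x]; [l] makes this set
    nonempty and [u] bounds it. If m + t x is positive, then -m/t lies above x for t < 0 and below x
    for t > 0. *)
Lemma positive_graph_extend G x l u :
  positive_graph G -> (exists r, G l r) -> P (x -' l) -> (exists r, G u r) -> P (u -' x) ->
  exists G' c, positive_graph G' /\ (forall y r, G y r -> G' y r) /\ G' x c.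
Proof.
  intros (Gadd & Gscal & Gpos) [rl Hl] Pl [ru Hu] Pu.
  assert (Hcut : forall m r m' r', G m r -> P (x -' m) -> G m' r' -> P (m' -' x) -> r <= r').
  { intros m r m' r' Hm Pm Hm' Pm'.
    assert (H : 0 <= r' + - 1 * r); [| lra].
    apply (Gpos (m' +' RtoC (- 1) *: m)).
    - apply Gadd; auto.
    - replace (m' +' RtoC (-1) *: m) with ((m' -' x) +' (x -' m)); [auto |].
      unfold bs_sub; rewrite <- bs_add_assoc, (bs_add_assoc _ (bs_opp x)), bs_add_opp, bs_add_zero.
      f_equal; rewrite opp_scal; f_equal; creal. }
  destruct (completeness (fun r => exists m, G m r /\ P (x -' m))) as [c [Hub Hlub]].
  { exists ru; intros r (m & Hm & Pm); apply (Hcut m r u ru); auto. }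
  { exists rl, l; auto. }
  exists (fun y s => exists m r t, G m r /\ y = m +' RtoC t *: x /\ s = r + t * c), c.
  assert (G0 : G bs_zero 0).
  { replace 0 with (0 * rl) by ring; rewrite <- (scal_zero_l A l); apply (Gscal 0); auto. }
  split; [split; [| split] | split].
  - intros y1 s1 y2 s2 (m1 & r1 & t1 & H1 & -> & ->) (m2 & r2 & t2 & H2 & -> & ->).
    exists (m1 +' m2), (r1 + r2), (t1 + t2); split; [auto | split; [| ring]].
    replace (RtoC (t1 + t2)) with (Cadd (RtoC t1) (RtoC t2)) by creal.
    rewrite bs_scal_addl, !bs_add_assoc; f_equal.
    rewrite <- !bs_add_assoc; f_equal; apply bs_add_comm.
  - intros t y s (m & r & t' & H & -> & ->).
    exists (RtoC t *: m), (t * r), (t * t'); split; [auto | split; [| ring]].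
    rewrite bs_scal_addr, bs_scal_assoc; do 2 f_equal; creal.
  - intros y s (m & r & t & H & -> & ->) Py.
    destruct (Rtotal_order t 0) as [Ht | [-> | Ht]].
    + assert (Hs : 0 < / - t) by (apply Rinv_0_lt_compat; lra).
      assert (Hc : c <= / - t * r).
      { apply Hlub; intros r' (m' & Hm' & Pm').
        apply (Hcut m' r' (RtoC (/ - t) *: m)); auto.
        replace (RtoC (/ - t) *: m -' x) with (RtoC (/ - t) *: (m +' RtoC t *: x));
          [apply Pscal; auto; lra |].
        unfold bs_sub; rewrite bs_scal_addr, bs_scal_assoc, opp_scal; do 2 f_equal; creal. }
      apply Rmult_le_compat_l with (r := - t) in Hc; [| lra].
      rewrite <- Rmult_assoc, Rinv_r in Hc by lra; lra.
    + rewrite Rmult_0_l, Rplus_0_r; apply (Gpos m); auto.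
      replace m with (m +' RtoC 0 *: x); auto.
      change (RtoC 0) with C0; rewrite scal_zero_l, add_zero_r; auto.
    + assert (Hs : 0 < / t) by (apply Rinv_0_lt_compat; lra).
      assert (Hc : - / t * r <= c).
      { apply Hub; exists (RtoC (- / t) *: m); split; auto.
        replace (x -' RtoC (- / t) *: m) with (RtoC (/ t) *: (m +' RtoC t *: x));
          [apply Pscal; auto; lra |].
        unfold bs_sub; rewrite bs_add_comm, bs_scal_addr, !bs_scal_assoc, opp_scal, bs_scal_assoc.
        rewrite bs_add_comm.
        rewrite (bs_add_comm _ x); f_equal; [f_equal; creal |].
        rewrite <- (bs_scal_one _ x) at 2; f_equal; creal. }
      apply Rmult_le_compat_l with (r := t) in Hc; [| lra].
      replace (t * (- / t * r)) with (- r) in Hc by (field; lra); lra.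
  - intros y r Hy; exists y, r, 0; split; [auto | split; [| ring]].
    change (RtoC 0) with C0; rewrite scal_zero_l, add_zero_r; auto.
  - exists bs_zero, 0, 1; split; [auto | split; [| ring]].
    change (RtoC 1) with C1; rewrite bs_scal_one, bs_add_zero; auto.
Qed.

Theorem riesz_extension (G0 : A -> R -> Prop) (H : A -> Prop) :
  positive_graph G0 -> G0 bs_zero 0 ->
  (forall x, H x -> exists l r u s, G0 l r /\ P (x -' l) /\ G0 u s /\ P (u -' x)) ->
  exists G, positive_graph G /\ (forall x r, G0 x r -> G x r) /\
    forall x, H x -> exists r, G x r.
Proof.
  intros HG0 HG00 Hunit.
  pose (gr := fun (X : A * R -> Prop) x r => X (x, r)).
  pose (adm := fun X : A * R -> Prop => (forall p, ~ X p) \/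
    (positive_graph (gr X) /\ forall x r, G0 x r -> gr X x r)).
  destruct (classical_sets.Zorn_bigcup (P := adm)) as [M [HM Hmax]].
  - intros F HF Htot.
    destruct (classic (exists X, F X /\ exists p, X p)) as [(X0 & FX0 & p0 & Hp0) | Hno].
    + right.
      assert (Hgood : forall X p, F X -> X p ->
                positive_graph (gr X) /\ forall x r, G0 x r -> gr X x r).
      { intros X p FX Xp; destruct (HF X FX) as [He | Hg]; auto; destruct (He p); auto. }
      split; [split; [| split] |].
      * intros x r y s [X FX Xx] [Y FY Yy].
        destruct (Htot X Y FX FY) as [HXY | HYX].
        -- exists Y; auto; destruct (Hgood Y _ FY Yy) as ((Hadd & _) & _).
           apply Hadd; auto; apply HXY; auto.
        -- exists X; auto; destruct (Hgood X _ FX Xx) as ((Hadd & _) & _).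
           apply Hadd; auto; apply HYX; auto.
      * intros t x r [X FX Xx]; exists X; auto.
        destruct (Hgood X _ FX Xx) as ((_ & Hscal & _) & _); apply Hscal; auto.
      * intros x r [X FX Xx].
        destruct (Hgood X _ FX Xx) as ((_ & _ & Hpos) & _); apply Hpos; auto.
      * intros x r Hx; exists X0; auto.
        destruct (Hgood X0 p0 FX0 Hp0) as (_ & H0); apply H0; auto.
    + left; intros p [X FX Xp]; apply Hno; exists X; split; auto; exists p; auto.
  - assert (HMg : positive_graph (gr M) /\ forall x r, G0 x r -> gr M x r).
    { destruct HM as [He | Hg]; auto; exfalso.
      apply (Hmax (fun p => G0 (fst p) (snd p))).
      - split; [intros p Hp; destruct (He p Hp) |].
        intro Hsub; apply (He (bs_zero, 0)), Hsub; auto.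
      - right; split; auto. }
    destruct HMg as [HMg HM0].
    exists (gr M); split; [auto | split; [auto |]].
    intros x Hx; apply NNPP; intro Hno.
    destruct (Hunit x Hx) as (l & r & u & s & Hl & Pl & Hu & Pu).
    destruct (positive_graph_extend (gr M) x l u HMg) as (G' & c & HG' & Hsub & Hc); auto.
    + exists r; auto.
    + exists s; auto.
    + apply (Hmax (fun p => G' (fst p) (snd p))).
      * split; [intros [y t] Hy; apply Hsub; auto |].
        intro Hsub'; apply Hno; exists c; apply (Hsub' (x, c)); auto.
      * right; split; auto; intros y t Hy; apply Hsub, HM0; auto.
Qed.
End RieszExtension.

(** * State extension in a unital algebra *)

Section StateExtension.
Variable U : UnitalBanachStarAlgebra.
Hypothesis HU : forall h : U, h^* = h -> forall c, Cim c <> 0 -> invertible U (c *: one +' h).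
Implicit Types x y d h : U.

(** Makes the unit an order unit of the cone, as Riesz' theorem requires, and later bounds the
    extension by the norm. *)
Lemma pos_of_norm t h : h^* = h -> bs_norm h <= t -> pos U (RtoC t *: one +' h).
Proof.
  intros Hh Ht; pose proof (bs_norm_nonneg _ h) as Hn; split.
  - rewrite bs_star_add, star_RtoC, star_one, Hh; auto.
  - intros s Hs.
    apply invertible_scal_eq with (RtoC (s + t)) (one -' bs_opp (RtoC (/ (s + t)) *: h)).
    + intro E; apply (f_equal Cre) in E; simpl in E; lra.
    + alg.
    + apply small_invertible, small_norm.
      assert (0 < / (s + t)) by (apply Rinv_0_lt_compat; lra).
      rewrite norm_opp, norm_scal_R by lra.
      apply Rmult_lt_reg_l with (s + t); [lra |].
      rewrite <- Rmult_assoc, Rinv_r by lra; lra.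
Qed.

Definition re_part x := RtoC (1 / 2) *: (x +' x^*).
Definition im_part x := mkC 0 (-1 / 2) *: (x -' x^*).

Lemma re_part_hermitian x : (re_part x)^* = re_part x.
Proof. unfold re_part; rewrite star_RtoC; stars; alg. Qed.

Lemma im_part_hermitian x : (im_part x)^* = im_part x.
Proof.
  unfold im_part; stars; replace (Cconj (mkC 0 (-1 / 2))) with (mkC 0 (1 / 2)) by creal; alg.
Qed.

Lemma re_im_part x : x = re_part x +' mkC 0 1 *: im_part x.
Proof. unfold re_part, im_part; alg. Qed.

(** The norm bound concerns hermitian elements only, the involution not being continuous; the weak
    continuity of a state asks for no more. *)
Theorem unital_state_extension (D : U -> Prop) (phi : U -> Cpx) :
  D bs_zero ->
  (forall x y, D x -> D y -> D (x +' y)) -> (forall c x, D x -> D (c *: x)) ->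
  (forall x y, D x -> D y -> D (x *' y)) -> (forall x, D x -> D x^*) ->
  (forall m d, D d -> Rabs m <= bs_norm (RtoC m *: one +' d)) ->
  is_state U D phi ->
  exists psi : U -> Cpx,
    (forall x y, psi (x +' y) = Cadd (psi x) (psi y)) /\
    (forall c x, psi (c *: x) = Cmul c (psi x)) /\
    (forall x, Cim (psi (x^* *' x)) = 0 /\ 0 <= Cre (psi (x^* *' x))) /\
    psi one = C1 /\
    (forall h, h^* = h -> Cmod (psi h) <= bs_norm h) /\
    (forall d, D d -> psi d = phi d).
Proof.
  intros D0 Dadd Dscal Dmul Dstar Dsep Hphi.
  assert (Hpadd : forall x y, D x -> D y -> phi (x +' y) = Cadd (phi x) (phi y)) by apply Hphi.
  assert (Hpscal : forall c x, D x -> phi (c *: x) = Cmul c (phi x)) by apply Hphi.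
  assert (Hp0 : phi bs_zero = C0).
  { rewrite <- (scal_zero_l U bs_zero), Hpscal by auto; creal. }
  pose (G0 := fun x r => exists m d, D d /\ d^* = d /\ x = RtoC m *: one +' d /\
                                     r = m + Cre (phi d)).
  assert (HG0 : positive_graph U (pos U) G0).
  { split; [| split].
    - intros x r y s (m & d & Hd & Hds & -> & ->) (m' & d' & Hd' & Hds' & -> & ->).
      exists (m + m'), (d +' d'); repeat split; auto.
      + rewrite bs_star_add, Hds, Hds'; auto.
      + alg.
      + rewrite Hpadd by auto; simpl; ring.
    - intros t x r (m & d & Hd & Hds & -> & ->).
      exists (t * m), (RtoC t *: d); repeat split; auto.
      + rewrite star_RtoC, Hds; auto.
      + alg.
      + rewrite Hpscal by auto; simpl; ring.
    - intros x r (m & d & Hd & Hds & -> & ->) Hpos.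
      apply (state_affine_pos U HU D) ; auto. }
  assert (HG0m : forall m, G0 (RtoC m *: one) m).
  { intro m; exists m, bs_zero; repeat split; auto; [apply star_zero | alg |].
    rewrite Hp0; simpl; ring. }
  destruct (riesz_extension U (pos U) (pos_add U HU) (pos_scal U) G0 (fun x => x^* = x) HG0)
    as (G & HG & HGG0 & Htot).
  { replace (bs_zero : U) with (RtoC 0 *: (one : U)) by alg; apply HG0m. }
  { intros x Hx; exists (RtoC (- bs_norm x) *: one), (- bs_norm x),
      (RtoC (bs_norm x) *: one), (bs_norm x); split; [auto | split; [| split; [auto |]]].
    - replace (x -' RtoC (- bs_norm x) *: one) with (RtoC (bs_norm x) *: one +' x) by alg.
      apply pos_of_norm; auto; lra.
    - replace (RtoC (bs_norm x) *: one -' x) with (RtoC (bs_norm x) *: one +' bs_opp x) by alg.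
      apply pos_of_norm; [rewrite star_opp, Hx | rewrite norm_opp]; auto; lra. }
  destruct HG as (Gadd & Gscal & Gpos).
  assert (Guniq : forall x r s, G x r -> G x s -> r = s).
  { assert (Hle : forall x r s, G x r -> G x s -> 0 <= r + -1 * s).
    { intros x r s Hr Hs; apply (Gpos (x +' RtoC (-1) *: x)); auto.
      replace (x +' RtoC (-1) *: x) with ((bs_zero : U) *' bs_zero) by alg.
      apply pos_square; auto; apply star_zero. }
    intros x r s Hr Hs; pose proof (Hle x r s Hr Hs); pose proof (Hle x s r Hs Hr); lra. }
  assert (Hf : exists f : U -> R, forall x, x^* = x -> G x (f x)).
  { assert (Hex : forall x, exists r, x^* = x -> G x r).
    { intro x; destruct (classic (x^* = x)) as [Hx | Hx].
      - destruct (Htot x Hx) as [r Hr]; exists r; auto.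
      - exists 0; intro; contradiction. }
    exists (fun x => proj1_sig (constructive_indefinite_description _ (Hex x))).
    intro x; destruct (constructive_indefinite_description _ (Hex x)); auto. }
  destruct Hf as [f Hf].
  assert (Hfadd : forall x y, x^* = x -> y^* = y -> f (x +' y) = f x + f y).
  { intros x y Hx Hy; apply (Guniq (x +' y)); auto.
    apply Hf; rewrite bs_star_add, Hx, Hy; auto. }
  assert (Hfscal : forall t x, x^* = x -> f (RtoC t *: x) = t * f x).
  { intros t x Hx; apply (Guniq (RtoC t *: x)); auto.
    apply Hf; rewrite star_RtoC, Hx; auto. }
  assert (Hf0 : f bs_zero = 0).
  { rewrite <- (scal_zero_l U bs_zero); change C0 with (RtoC 0).
    rewrite Hfscal by apply star_zero; ring. }
  pose (psi := fun x => mkC (f (re_part x)) (f (im_part x))).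
  assert (Hpsih : forall h, h^* = h -> psi h = RtoC (f h)).
  { intros h Hh; unfold psi, re_part, im_part; rewrite Hh.
    replace (RtoC (1 / 2) *: (h +' h)) with h by alg.
    replace (mkC 0 (-1 / 2) *: (h -' h)) with (bs_zero : U) by alg.
    rewrite Hf0; auto. }
  pose proof re_part_hermitian as Hre; pose proof im_part_hermitian as Him.
  assert (Hadd : forall x y, psi (x +' y) = Cadd (psi x) (psi y)).
  { intros x y; unfold psi.
    replace (re_part (x +' y)) with (re_part x +' re_part y) by (unfold re_part; stars; alg).
    replace (im_part (x +' y)) with (im_part x +' im_part y) by (unfold im_part; stars; alg).
    rewrite !Hfadd by auto; auto. }
  assert (Hscal : forall c x, psi (c *: x) = Cmul c (psi x)).
  { intros c x; unfold psi.
    replace (re_part (c *: x)) with (RtoC (Cre c) *: re_part x +' RtoC (- Cim c) *: im_part x)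
      by (unfold re_part, im_part; stars; alg).
    replace (im_part (c *: x)) with (RtoC (Cre c) *: im_part x +' RtoC (Cim c) *: re_part x)
      by (unfold re_part, im_part; stars; alg).
    rewrite !Hfadd by (rewrite star_RtoC; f_equal; auto).
    rewrite !Hfscal by auto; creal. }
  (* The graph records only real parts; [state_real] supplies the vanishing imaginary part. *)
  assert (HfD : forall d, D d -> d^* = d -> psi d = phi d).
  { intros d Hd Hds; rewrite Hpsih by auto.
    assert (Hi : Cim (phi d) = 0) by (apply (state_real U D); auto).
    apply Cpx_ext; simpl; auto.
    apply (Guniq d); auto; apply HGG0.
    exists 0, d; repeat split; auto; [alg | ring]. }
  exists psi; repeat split; auto.
  - rewrite Hpsih; [auto | stars; auto].
  - rewrite Hpsih by (stars; auto); simpl.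
    apply (Gpos (x^* *' x)); [apply Hf; stars; auto | apply shirali_ford; auto].
  - rewrite Hpsih by apply star_one.
    replace (f one) with 1; auto.
    apply (Guniq one); [| apply Hf, star_one].
    apply HGG0; replace (one : U) with (RtoC 1 *: (one : U)) by alg; apply HG0m.
  - intros h Hh; rewrite Hpsih, Cmod_RtoC by auto.
    assert (Hb : forall h, h^* = h -> 0 <= bs_norm h + f h).
    { intros k Hk; apply (Gpos (RtoC (bs_norm k) *: one +' k)); auto.
      apply pos_of_norm; auto; lra. }
    pose proof (Hb h Hh) as H1; pose proof (Hb (RtoC (-1) *: h)) as H2.
    rewrite star_RtoC, Hh in H2; specialize (H2 eq_refl).
    rewrite Hfscal, bs_norm_scal, Cmod_RtoC, Rabs_left in H2 by (auto; lra).
    apply Rabs_le; lra.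
  - intros d Hd.
    assert (HDre : D (re_part d)).
    { apply Dscal, Dadd; auto. }
    assert (HDim : D (im_part d)).
    { unfold im_part; replace (d -' d^*) with (d +' Copp C1 *: d^*) by alg; auto. }
    rewrite (re_im_part d), Hadd, Hscal, Hpadd, Hpscal by auto.
    rewrite !HfD by auto; auto.
Qed.
End StateExtension.

(** * Unitization *)

Section Unitization.
Variable A : BanachStarAlgebra.

(** [alg] presupposes a unit, so the axioms of the unitization are checked by matching summands up
    to associativity and commutativity. *)
Ltac add_ac :=
  rewrite <- ?bs_add_assoc;
  repeat match goal with
  | |- ?x = ?x => reflexivity
  | |- bs_add ?x _ = bs_add ?x _ => apply (f_equal (bs_add x))
  | |- bs_add ?x _ = bs_add ?y ?r => rewrite (bs_add_comm A y r); rewrite <- ?bs_add_assoc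
  | |- ?x = bs_add ?y ?r => rewrite (bs_add_comm A y r); rewrite <- ?bs_add_assoc
  end.

Let car : Type := (Cpx * A)%type.
Let uzero : car := (C0, bs_zero).
Let uadd (p q : car) : car := (Cadd (fst p) (fst q), snd p +' snd q).
Let uopp (p : car) : car := (Copp (fst p), bs_opp (snd p)).
Let uscal (c : Cpx) (p : car) : car := (Cmul c (fst p), c *: snd p).
Let umul (p q : car) : car :=
  (Cmul (fst p) (fst q), fst p *: snd q +' fst q *: snd p +' snd p *' snd q).
Let ustar (p : car) : car := (Cconj (fst p), (snd p)^*).
(** The l^1 norm: it is submultiplicative, makes [embed] isometric and dominates the scalar part. *)
Let unorm (p : car) : R := Cmod (fst p) + bs_norm (snd p).

Lemma pair_ext (p q : car) : fst p = fst q -> snd p = snd q -> p = q.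
Proof. destruct p, q; simpl; intros; subst; auto. Qed.

Lemma unitization_complete (u : nat -> car) :
  (forall eps, 0 < eps -> exists N, forall m n, (N <= m)%nat -> (N <= n)%nat ->
     unorm (uadd (u m) (uopp (u n))) < eps) ->
  exists l, forall eps, 0 < eps -> exists N, forall n, (N <= n)%nat ->
     unorm (uadd (u n) (uopp l)) < eps.
Proof.
  intro H; unfold unorm in *; simpl in *.
  assert (Hre : Cauchy_crit (fun n => Cre (fst (u n)))).
  { intros eps He; destruct (H eps He) as [N HN]; exists N; intros n m Hn Hm.
    specialize (HN n m Hn Hm).
    pose proof (Cmod_re (Cadd (fst (u n)) (Copp (fst (u m))))) as Hc; simpl in Hc.
    pose proof (bs_norm_nonneg _ (snd (u n) +' bs_opp (snd (u m)))).
    unfold Rdist, Rminus; lra. }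
  assert (Him : Cauchy_crit (fun n => Cim (fst (u n)))).
  { intros eps He; destruct (H eps He) as [N HN]; exists N; intros n m Hn Hm.
    specialize (HN n m Hn Hm).
    pose proof (Cmod_im (Cadd (fst (u n)) (Copp (fst (u m))))) as Hc; simpl in Hc.
    pose proof (bs_norm_nonneg _ (snd (u n) +' bs_opp (snd (u m)))).
    unfold Rdist, Rminus; lra. }
  destruct (R_complete _ Hre) as [r Hr]; destruct (R_complete _ Him) as [i Hi].
  destruct (bs_complete A (fun n => snd (u n))) as [a Ha].
  { intros eps He; destruct (H eps He) as [N HN]; exists N; intros m n Hm Hn.
    specialize (HN m n Hm Hn).
    pose proof (Cmod_ge0 (Cadd (fst (u m)) (Copp (fst (u n))))); lra. }
  exists (mkC r i, a); intros eps He; simpl.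
  destruct (Hr (eps / 3)) as [N1 H1]; [lra |].
  destruct (Hi (eps / 3)) as [N2 H2]; [lra |].
  destruct (Ha (eps / 3)) as [N3 H3]; [lra |].
  exists (N1 + N2 + N3)%nat; intros n Hn.
  specialize (H1 n ltac:(lia)); specialize (H2 n ltac:(lia)); specialize (H3 n ltac:(lia)).
  pose proof (Cmod_le_abs (Cadd (fst (u n)) (Copp (mkC r i)))) as Hc; simpl in Hc.
  unfold Rdist, Rminus in *; lra.
Qed.

Definition unitization_alg : BanachStarAlgebra.
Proof.
  refine (Build_BanachStarAlgebra car uzero uadd uopp uscal umul ustar unorm
    _ _ _ _ _ _ _ _ _ _ _ _ _ _ _ _ _ _ _ _ _ _ unitization_complete);
    intros; try (apply pair_ext; simpl); try solve [creal].
  - apply bs_add_assoc.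
  - apply bs_add_comm.
  - apply bs_add_zero.
  - apply bs_add_opp.
  - apply bs_scal_assoc.
  - apply bs_scal_one.
  - apply bs_scal_addl.
  - apply bs_scal_addr.
  - rewrite !bs_mul_addr, !bs_mul_addl, !bs_scal_addr, !bs_mul_scalr, !bs_mul_scall,
      !bs_scal_assoc, bs_mul_assoc.
    replace (Cmul (fst z) (fst x)) with (Cmul (fst x) (fst z)) by creal.
    replace (Cmul (fst z) (fst y)) with (Cmul (fst y) (fst z)) by creal.
    add_ac.
  - rewrite bs_mul_addl, bs_scal_addl, bs_scal_addr; add_ac.
  - rewrite bs_mul_addr, bs_scal_addl, bs_scal_addr; add_ac.
  - rewrite bs_mul_scall, !bs_scal_addr, !bs_scal_assoc.
    replace (Cmul (fst y) a) with (Cmul a (fst y)) by creal; auto.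
  - rewrite bs_mul_scalr, !bs_scal_addr, !bs_scal_assoc.
    replace (Cmul (fst x) a) with (Cmul a (fst x)) by creal; auto.
  - apply bs_star_add.
  - apply bs_star_scal.
  - rewrite !bs_star_add, !bs_star_scal, bs_star_mul; add_ac.
  - apply bs_star_star.
  - unfold unorm; pose proof (Cmod_ge0 (fst x)); pose proof (bs_norm_nonneg _ (snd x)); lra.
  - unfold unorm in H; pose proof (Cmod_ge0 (fst x)); pose proof (bs_norm_nonneg _ (snd x)).
    apply Cmod_eq0; lra.
  - unfold unorm in H; pose proof (Cmod_ge0 (fst x)); pose proof (bs_norm_nonneg _ (snd x)).
    apply bs_norm_eq0; lra.
  - unfold unorm; simpl.
    pose proof (Cmod_triangle (fst x) (fst y)).
    pose proof (bs_norm_triangle _ (snd x) (snd y)); lra.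
  - unfold unorm; simpl; rewrite Cmod_mul, bs_norm_scal; ring.
  - unfold unorm; simpl; rewrite Cmod_mul.
    pose proof (bs_norm_triangle _ (fst x *: snd y +' fst y *: snd x) (snd x *' snd y)).
    pose proof (bs_norm_triangle _ (fst x *: snd y) (fst y *: snd x)).
    pose proof (bs_norm_mul _ (snd x) (snd y)).
    rewrite !bs_norm_scal in *; lra.
Defined.

Definition unitization : UnitalBanachStarAlgebra.
Proof.
  refine (Build_UnitalBanachStarAlgebra unitization_alg (C1, bs_zero) _ _ _).
  - intro x; apply pair_ext; simpl; [creal |].
    rewrite bs_scal_one, scal_zero_r, mul_zero_l, !add_zero_r; auto.
  - intro x; apply pair_ext; simpl; [creal |].
    rewrite bs_scal_one, scal_zero_r, mul_zero_r, add_zero_r, bs_add_zero; auto.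
  - simpl; unfold unorm; simpl; rewrite norm_zero, Rplus_0_r.
    apply Cmod_unique; simpl; lra.
Defined.

Definition embed (a : A) : unitization := (C0, a).

Lemma embed_add a b : embed (a +' b) = embed a +' embed b.
Proof. apply pair_ext; simpl; [creal | auto]. Qed.

Lemma embed_scal c a : embed (c *: a) = c *: embed a.
Proof. apply pair_ext; simpl; [creal | auto]. Qed.

Lemma embed_mul a b : embed (a *' b) = embed a *' embed b.
Proof.
  apply pair_ext; simpl; [creal |].
  rewrite !scal_zero_l, !bs_add_zero; auto.
Qed.

Lemma embed_star a : embed a^* = (embed a)^*.
Proof. apply pair_ext; simpl; [creal | auto]. Qed.

Lemma embed_sub a b : embed (a -' b) = embed a -' embed b.
Proof. apply pair_ext; simpl; [creal | auto]. Qed.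

Lemma embed_zero : embed bs_zero = bs_zero.
Proof. reflexivity. Qed.

Lemma norm_embed a : bs_norm (embed a) = bs_norm a.
Proof.
  simpl; unfold unorm; simpl.
  replace (Cmod C0) with 0; [ring | symmetry; apply Cmod_unique; simpl; lra].
Qed.

Lemma norm_affine_embed m a : Rabs m <= bs_norm (RtoC m *: one +' embed a).
Proof.
  simpl; unfold unorm; simpl.
  replace (Cadd (Cmul (RtoC m) C1) C0) with (RtoC m) by creal.
  rewrite Cmod_RtoC.
  pose proof (bs_norm_nonneg _ (RtoC m *: bs_zero +' a)); lra.
Qed.

(** The scalar part l of [h] is real. With z = -(c + l) the element is -z (1 - a/z), and a
    quasi-inverse y of x = a/z gives the inverse 1 - y of 1 - x. *)
Lemma unitization_hermitian : hermitian_algebra A ->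
  forall h : unitization, h^* = h -> forall c, Cim c <> 0 -> invertible unitization (c *: one +' h).
Proof.
  intros HA [l a] Hh c Hc.
  assert (Hl : Cim l = 0).
  { apply (f_equal (fun p => Cim (fst p))) in Hh; simpl in Hh; lra. }
  assert (Ha : hermitian_elt A a) by apply (f_equal snd Hh).
  set (z := Copp (Cadd c l)).
  assert (Hz : Cim z <> 0) by (simpl; lra).
  assert (Hz0 : z <> C0) by (intro E; apply Hz; rewrite E; auto).
  assert (Hq : quasi_invertible A (Cinv z *: a)).
  { apply NNPP; intro Hno; apply Hz, (HA a Ha); right; auto. }
  set (x := Cinv z *: a) in *.
  assert (E : c *: one +' ((l, a) : unitization) = Copp z *: (one -' embed x)).
  { apply pair_ext; simpl; [unfold z; creal |].
    unfold x; rewrite scal_zero_r, opp_scal, !bs_add_zero, !bs_scal_assoc.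
    replace (Cmul (Cmul (Copp z) (Copp C1)) (Cinv z)) with (Cmul z (Cinv z)) by creal.
    rewrite Cmul_inv, bs_scal_one; auto. }
  rewrite E; apply invertible_scal.
  - intro E0; apply Hz; apply (f_equal Cim) in E0; simpl in *; lra.
  - destruct Hq as (y & H1 & H2); exists (one -' embed y).
    split.
    + transitivity (one -' embed (qprod A x y)).
      * unfold qprod; rewrite embed_sub, embed_add, embed_mul; alg.
      * rewrite H1, embed_zero; alg.
    + transitivity (one -' embed (qprod A y x)).
      * unfold qprod; rewrite embed_sub, embed_add, embed_mul; alg.
      * rewrite H2, embed_zero; alg.
Qed.
End Unitization.

(** * Passage to the unitization and back *)

Theorem theorem29p2 (A : BanachStarAlgebra) (D : A -> Prop) :
  hermitian_algebra A ->
  closed_star_subalgebra A D ->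
  forall phi : A -> Cpx, is_state A D phi ->
  exists psi : A -> Cpx, is_state A (fun _ => True) psi /\
    (forall x, D x -> psi x = phi x).
Proof.
  intros HA (D0 & Dadd & Dscal & Dmul & Dstar & _) phi ((Hadd & Hscal) & Hpos & Hweak & Hvar).
  set (E := embed A).
  set (D' := fun p : unitization A => exists a, D a /\ p = E a).
  set (phi' := fun p : unitization A => phi (snd p)).
  destruct (unital_state_extension (unitization A) (unitization_hermitian A HA) D' phi')
    as (psi & Padd & Pscal & Ppos & Pone & Pnorm & Pext).
  - exists bs_zero; auto.
  - intros x y (a & Ha & ->) (b & Hb & ->); exists (a +' b); split; auto.
    symmetry; apply embed_add.
  - intros c x (a & Ha & ->); exists (c *: a); split; auto; symmetry; apply embed_scal.
  - intros x y (a & Ha & ->) (b & Hb & ->); exists (a *' b); split; auto.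
    symmetry; apply embed_mul.
  - intros x (a & Ha & ->); exists a^*; split; auto; symmetry; apply embed_star.
  - intros m d (a & Ha & ->); apply norm_affine_embed.
  - split; [split | split; [| split]].
    + intros x y (a & Ha & ->) (b & Hb & ->); apply Hadd; auto.
    + intros c x (a & Ha & ->); apply Hscal; auto.
    + intros x (a & Ha & ->); unfold E, phi'; rewrite <- embed_star, <- embed_mul.
      apply Hpos; auto.
    + intros x (c & Hc & ->) y (b0 & Hb0 & ->) Hb0s eps He.
      destruct (Hweak c Hc b0 Hb0) with (eps := eps) as (d & Hd & H); auto.
      { apply (f_equal snd Hb0s). }
      exists d; split; auto.
      intros z (b & Hb & ->) Hbs; unfold E, phi'.
      rewrite <- embed_sub, norm_embed, <- embed_star, <- !embed_mul.
      apply H; auto; apply (f_equal snd Hbs).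
    + destruct Hvar as [[_ Hv] Hmin]; split.
      * split; [lra |]; intros x (a & Ha & ->); unfold E, phi'.
        rewrite <- embed_star, <- embed_mul; apply Hv; auto.
      * intros g [Hg Hb]; apply Hmin; split; auto; intros a Ha.
        specialize (Hb (E a)); unfold E, phi' in Hb.
        rewrite <- embed_star, <- embed_mul in Hb; apply Hb; exists a; auto.
  - assert (Hext : forall x, D x -> psi (E x) = phi x).
    { intros x Hx; apply (Pext (E x)); exists x; auto. }
    exists (fun a => psi (E a)); split; auto.
    split; [split | split; [| split; [| split]]].
    + intros x y _ _; unfold E; rewrite embed_add; apply Padd.
    + intros c x _; unfold E; rewrite embed_scal; apply Pscal.
    + intros b _; unfold E; rewrite embed_mul, embed_star; apply Ppos.
    + intros c _ b0 _ Hb0 eps He.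
      set (K := bs_norm c^* * bs_norm c + 1).
      assert (HK : 0 < K).
      { pose proof (bs_norm_nonneg _ c); pose proof (bs_norm_nonneg _ c^*).
        unfold K; nra. }
      exists (eps / K); split; [apply Rdiv_lt_0_compat; auto |].
      intros b _ Hb Hlt.
      (* The difference is the value at c^* (b - b0) c, which is hermitian, so [Pnorm] applies. *)
      replace (Cadd (psi (E (c^* *' (b *' c)))) (Copp (psi (E (c^* *' (b0 *' c))))))
        with (psi (E (c^* *' (b -' b0) *' c))).
      * eapply Rle_lt_trans.
        { apply Pnorm; unfold E; rewrite <- embed_star; f_equal.
          unfold hermitian_elt in *; stars; rewrite Hb, Hb0, bs_mul_assoc; auto. }
        unfold E; rewrite norm_embed.
        pose proof (bs_norm_mul _ (c^* *' (b -' b0)) c) as H1.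
        pose proof (bs_norm_mul _ c^* (b -' b0)) as H2.
        pose proof (bs_norm_nonneg _ c) as H3; pose proof (bs_norm_nonneg _ (b -' b0)).
        apply Rlt_div_r in Hlt; auto; unfold K in Hlt.
        apply Rmult_le_compat_r with (r := bs_norm c) in H2; auto; lra.
      * transitivity (psi (E (c^* *' (b *' c)) +' Copp C1 *: E (c^* *' (b0 *' c)))).
        -- f_equal; unfold E; rewrite !embed_mul, embed_sub; alg.
        -- rewrite Padd, Pscal; f_equal; creal.
    (* Cauchy-Schwarz against the adjoined unit, where [psi] is 1. *)
    + split; [lra |]; intros b _.
      assert (HF : psd_form (unitization A) (fun _ => True) (fun x y => psi (y^* *' x))).
      { split; intros.
        - rewrite bs_mul_addr; apply Padd.
        - rewrite bs_star_add, bs_mul_addl; apply Padd.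
        - rewrite bs_mul_scalr; apply Pscal.
        - rewrite bs_star_scal, bs_mul_scall; apply Pscal.
        - apply Ppos. }
      pose proof (form_cauchy_schwarz _ _ _ HF (fun _ _ _ _ => I) (fun _ _ _ => I) (E b) one I I)
        as H; cbv beta in H.
      rewrite star_one, !mul_one_l, Pone in H.
      change (Cre C1) with 1 in H; unfold E in *; rewrite embed_mul, embed_star; lra.
    (* A variation bound on the whole algebra restricts to [D], where it is at least one. *)
    + intros g [Hg Hb]; apply Hvar; split; auto; intros a Ha.
      specialize (Hb a I); rewrite !Hext in Hb; auto.
Qed.
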